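(* Let $n\ge 2$ and let $I\subset R=k[x_0,\dots,x_n]$ be the ideal of two fat points of multiplicities $a_0\ge a_1$ in $\mathbb P^n$. Then for $q\ge 1$, \[ \beta_{q,q+a_0-1}(R/I)=\binom{a_0+n-2}{a_0+q-1}\binom{a_0+q-2}{q-1}+\sum_{i=1}^{a_0-a_1}\binom{a_0-i+n-2}{a_0-i}\binom{n-1}{q-1}, \] \[ \beta_{q,q+a_0+i}(R/I)=\binom{a_1-i+n-3}{a_1-i-1}\binom{n-1}{q-1}\quad\text{for } i=0,\dots,a_1-1, \] $\beta_{0,0}(R/I)=1$, and all other graded Betti numbers of $R/I$ are zero.
   Context: $k$ is a field; $R=k[x_0,\dots,x_n]$ is standard graded; $\beta_{i,j}(M)=\dim_k \operatorname{Tor}_i^R(k,M)_j$ denotes the $(i,j)$-th graded Betti number. The multiplicities are positive integers. By a linear change of coordinates, the ideal of two fat points (at distinct points) of multiplicities $a_0\ge a_1$ is taken to be $I=(x_1,x_2,\dots,x_n)^{a_0}\cap(x_0,x_2,\dots,x_n)^{a_1}$. Binomial coefficients $\binom{a}{b}$ are zero for $b>a\ge 0$, and empty sums are zero. *)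

(* Defs.v *)
From HB Require Import structures.
From mathcomp Require Import all_boot all_order all_algebra.
From mathcomp Require Import mpoly.

Set Implicit Arguments.
Unset Strict Implicit.
Unset Printing Implicit Defensive.

Import GRing.Theory.
Local Open Scope ring_scope.

Section Ideals.
Variable R : comNzRingType.

Definition ideal_gen (S : R -> Prop) (p : R) : Prop :=
  exists2 s : seq (R * R),
    (forall u, u \in s -> S u.2) & p = \sum_(u <- s) u.1 * u.2.

Definition ideal_mul (I J : R -> Prop) : R -> Prop :=
  ideal_gen (fun p => exists f g, [/\ I f, J g & p = f * g]).

Definition ideal_pow (I : R -> Prop) (m : nat) : R -> Prop :=
  iter m (ideal_mul I) (fun=> True).

Definition ideal_cap (I J : R -> Prop) (p : R) : Prop := I p /\ J p.

End Ideals.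

Section GradedBetti.
Variables (k : fieldType) (m : nat).
Local Notation R := {mpoly k[m]}.

(* p lies in the component R_d, where R_d = 0 for d < 0. *)
Definition homogz (d : int) (p : R) : Prop :=
  p != 0 -> exists2 e : nat, d = e%:Z & p \is e.-homog.

(* A sequence of finitely generated graded free R-modules
   F_i = \bigoplus_t R(- deg t) with maps diff i : F_(i+1) -> F_i and
   aug : F_0 -> R, all written as matrices acting on row vectors. *)
Record free_seq := FreeSeq {
  rk : nat -> nat;
  deg : forall i, 'I_(rk i) -> int;
  diff : forall i, 'M[R]_(rk i.+1, rk i);
  aug : 'cV[R]_(rk 0)
}.

(* F is a graded free resolution of R/I: the maps preserve degrees and
   ... -> F_1 -> F_0 -> R/I -> 0 is exact, where F_0 -> R/I is the class of
   aug modulo I. *)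
Record resolves (F : free_seq) (I : R -> Prop) : Prop := Resolves {
  diff_homog : forall i (s : 'I_(rk F i.+1)) (t : 'I_(rk F i)),
    homogz (deg s - deg t) (diff F i s t);
  aug_homog : forall t : 'I_(rk F 0), homogz (deg t) (aug F t 0);
  aug_surj : forall p : R, exists v : 'rV[R]_(rk F 0), I (p - (v *m aug F) 0 0);
  exact_aug : forall v : 'rV[R]_(rk F 0),
    I ((v *m aug F) 0 0) <-> exists w, v = w *m diff F 0;
  exact_diff : forall i (v : 'rV[R]_(rk F i.+1)),
    v *m diff F i = 0 <-> exists w, v = w *m diff F i.+1
}.

(* k (x)_R F : as k = R/(x_0, ..., x_(m-1)), tensoring with k keeps the constant
   coefficient of each matrix entry. *)
Definition kdiff (F : free_seq) i : 'M[k]_(rk F i.+1, rk F i) :=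
  map_mx (fun p : R => p@_0%MM) (diff F i).

(* Row space: the degree-j component of k (x)_R F_i. *)
Definition kdeg (F : free_seq) i (j : int) : 'M[k]_(rk F i) :=
  diag_mx (\row_t (deg t == j)%:R).

Definition kcycles (F : free_seq) i (j : int) : 'M[k]_(rk F i) :=
  match i with
  | 0 => kdeg F 0 j
  | i'.+1 => (kdeg F i'.+1 j :&: kermx (kdiff F i'))%MS
  end.

Definition kboundaries (F : free_seq) i (j : int) : 'M[k]_(rk F i.+1, rk F i) :=
  kdeg F i.+1 j *m kdiff F i.

(* dim_k H_i(k (x)_R F)_j *)
Definition tor_dim (F : free_seq) i (j : int) : nat :=
  (\rank (kcycles F i j) - \rank (kboundaries F i j))%N.

(* beta_(i,j)(R/I) = dim_k Tor_i^R(k, R/I)_j is equal to b. The value is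
   required for every graded free resolution, and one must exist, so that at
   most one b qualifies and no b qualifies vacuously. *)
Definition graded_betti (I : R -> Prop) (i : nat) (j : int) (b : nat) : Prop :=
  (exists F, resolves F I) /\ (forall F, resolves F I -> tor_dim F i j = b).

End GradedBetti.

Section FatPoints.
Variables (k : fieldType) (n : nat).

(* The ideal of the c-th coordinate point of P^n. *)
Definition point_ideal (c : nat) : {mpoly k[n.+1]} -> Prop :=
  ideal_gen (fun p => exists2 i : 'I_n.+1, (i : nat) != c & p = 'X_i).

Definition two_fat_points (a0 a1 : nat) : {mpoly k[n.+1]} -> Prop :=
  ideal_cap (ideal_pow (point_ideal 0) a0) (ideal_pow (point_ideal 1) a1).

End FatPoints.

Arguments two_fat_points : clear implicits.

(* Main.v *)
Require Import Defs.
From HB Require Import structures.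
From mathcomp Require Import all_boot all_order all_algebra.
From mathcomp Require Import mpoly.
From mathcomp Require Import ring zify.
From Stdlib Require Import IndefiniteDescription.

Set Implicit Arguments.
Unset Strict Implicit.
Unset Printing Implicit Defensive.

Import Order.TTheory GRing.Theory Num.Theory.
Local Open Scope ring_scope.

(** Put Y = {x_2, ..., x_n} and g_d = x_0^(a1 - d) x_1^(a0 - d), with truncated
exponents. A monomial of Y-degree d lies in I exactly when g_d divides it, and
g_(d+1) divides g_d, so I is generated by the products g_d y^f with f a
monomial of degree d in Y, for 0 <= d <= a0. The proof adds these generators
one at a time, in order of nonincreasing d: the degrees mdeg (g_d) + d then
never decrease, and every colon ideal is generated by variables.

For d < a0 the ideal generated so far contains g_d y^f x_i for every x_i in Y,
while a multiple of g_d y^f by a monomial without Y-variables is new; so the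
colon ideal is (Y), and R/(Y) is resolved by the Koszul complex on n - 1
elements. If F resolves R/J and K resolves R/(J : u), the mapping cone of a
lift of multiplication by u resolves R/(J + (u)) ([resolves_cone]). Generators
come in nondecreasing degree and K is linear, so the entries of the lift have
positive degree and the cone of two minimal resolutions is again minimal
([has_betti_colon]). Hence each g_d y^f contributes 'C(n - 1, q) to homological
degree q + 1, in degree q + mdeg (g_d) + d ([has_betti_tower]).

The start of this process, the ideal (Y)^a0, is treated by the same argument,
by induction on the number of variables: (Y, z)^a is generated by the
z^(a - d) y^f with f of degree d ([has_betti_power]). What remains is a
hockey-stick summation.

A Betti number is defined through every graded free resolution of R/I. Two of
them are compared by lifting the identity in both directions and contracting
the composites by homotopies; after tensoring with k, the homology of any
resolution becomes isomorphic to the generators of a minimal one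
([tor_dim_minimal]). *)

(** * Dependent choice *)

(** Resolutions are infinite and each map is chosen from the previous one, whose
    type depends on its index. *)
Lemma dependent_choice (T : nat -> Type) (Q : forall i, T i -> Prop)
    (C : forall i, T i -> T i.+1 -> Prop) (x0 : T 0) :
    Q 0 x0 ->
    (forall i x, Q i x -> exists2 y, Q i.+1 y & C i x y) ->
  exists f : forall i, T i,
    [/\ f 0 = x0, forall i, Q i (f i) & forall i, C i (f i) (f i.+1)].
Proof.
move=> Q0 step.
(* Choosing over the subtype cut out by Q keeps the invariant available to the
   recursion below. *)
have stepE i (u : {x | Q i x}) : {y : {y | Q i.+1 y} | C i (sval u) (sval y)}.
  apply: constructive_indefinite_description.
  by case: u => x Qx /=; have [y Qy Cxy] := step i x Qx; exists (exist _ y Qy).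
pose fix f i : {x : T i | Q i x} :=
  match i with 0 => exist _ x0 Q0 | i'.+1 => sval (stepE i' (f i')) end.
exists (fun i => sval (f i)); split=> // i; first exact: (svalP (f i)).
exact: (svalP (stepE i (f i))).
Qed.

(** * Homogeneous components of polynomials *)

Section HomogeneousComponents.
Variables (k : fieldType) (m : nat).
Local Notation R := {mpoly k[m]}.
Implicit Types (p q : R) (d e : int).

(** Integer degrees make [hcompM] valid without side conditions, since degree
    differences between generators may be negative. *)
Definition hcomp d p : R := if d is Posz e then pihomog mdeg e p else 0.

Lemma mcoeff_hcomp d p u :
  (hcomp d p)@_u = if (mdeg u)%:Z == d then p@_u else 0.
Proof.
case: d => [e|e] /=; last by rewrite mcoeff0.
rewrite pihomogE raddf_sum /=.
under eq_bigr do rewrite mcoeffZ mcoeffX.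
have [u_in|u_out] := boolP (u \in msupp p); last first.
  rewrite (memN_msupp_eq0 u_out) if_same big1_seq // => v /andP[_ v_in].
  by case: eqP v_in u_out => [-> ->|]; rewrite ?mulr0.
rewrite big_mkcond (bigD1_seq u) ?msupp_uniq //= eqxx mulr1.
rewrite big1 ?addr0 // => v /negbTE->; rewrite mulr0.
by case: ifP.
Qed.

Lemma homogzP d p :
  homogz d p <-> (forall u, u \in msupp p -> (mdeg u)%:Z = d).
Proof.
split=> [hp u up|hp p0].
  have p0 : p != 0 by apply: contraTneq up => ->; rewrite msupp0.
  by have [e -> /dhomogP/(_ u up) ->] := hp p0.
have [u up] : exists u, u \in msupp p.
  by exists (mlead p); rewrite mlead_supp.
exists (mdeg u); first by rewrite hp.
by apply/dhomogP => v vp; apply/eqP; rewrite -eqz_nat (hp v vp) -(hp u up).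
Qed.

Lemma hcompD d : {morph hcomp d : p q / p + q}.
Proof.
by move=> p q; apply/mpolyP=> u; rewrite mcoeffD !mcoeff_hcomp mcoeffD;
  case: ifP; rewrite ?addr0.
Qed.

Lemma hcomp0 d : hcomp d 0 = 0.
Proof. by apply/mpolyP=> u; rewrite mcoeff_hcomp mcoeff0 if_same. Qed.

Lemma hcompN d : {morph hcomp d : p / - p}.
Proof. by move=> p; apply/eqP; rewrite -addr_eq0 -hcompD addNr hcomp0. Qed.

Lemma hcomp_sum d (I : Type) (r : seq I) (f : I -> R) :
  hcomp d (\sum_(i <- r) f i) = \sum_(i <- r) hcomp d (f i).
Proof. exact: (big_morph _ (hcompD d) (hcomp0 d)). Qed.

Lemma homogz_hcomp d p : homogz d (hcomp d p).
Proof.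
apply/homogzP=> u; rewrite mcoeff_msupp mcoeff_hcomp.
by case: (_ =P d) => // _; rewrite eqxx.
Qed.

Lemma hcomp_homogz d e p :
  homogz e p -> hcomp d p = if d == e then p else 0.
Proof.
move/homogzP=> hp; apply/mpolyP=> u; rewrite mcoeff_hcomp.
have [/hp ->|/memN_msupp_eq0 pu] := boolP (u \in msupp p).
  by rewrite eq_sym; case: ifP; rewrite ?mcoeff0.
by rewrite pu if_same; case: ifP; rewrite ?pu ?mcoeff0.
Qed.

Lemma hcomp_id d p : homogz d p -> hcomp d p = p.
Proof. by move/hcomp_homogz->; rewrite eqxx. Qed.

Lemma homogz_sum d (I : Type) (r : seq I) (f : I -> R) :
  (forall i, homogz d (f i)) -> homogz d (\sum_(i <- r) f i).
Proof.
move=> hf; under eq_bigr => i _ do rewrite -(hcomp_id (hf i)).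
by rewrite -hcomp_sum; apply: homogz_hcomp.
Qed.

Lemma homogz0 d : homogz d (0 : R).
Proof. by rewrite /homogz eqxx. Qed.

Lemma homogz1 : homogz 0 (1 : R).
Proof. by move=> _; exists 0%N => //; apply: dhomog1. Qed.

Lemma homogzN d p : homogz d p -> homogz d (- p).
Proof. by move=> /homogzP hp; apply/homogzP=> u; rewrite (perm_mem (msuppN p)) => /hp. Qed.

Lemma homogzX (u : 'X_{1..m}) : homogz (mdeg u)%:Z ('X_[u] : R).
Proof. by move=> _; exists (mdeg u) => //; rewrite dhomogX. Qed.

Lemma homogzM d e p q : homogz d p -> homogz e q -> homogz (d + e) (p * q).
Proof.
move=> /homogzP hp /homogzP hq; apply/homogzP=> u /msuppM_le /allpairsP[[v w]].
by case=> /= /hp dv /hq dw ->; rewrite mdegD PoszD dv dw.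
Qed.

(** It suffices to take p a monomial, in which case both sides are that monomial
    times q or 0. *)
Lemma hcompM d e p q : homogz e q -> hcomp (d + e) (p * q) = hcomp d p * q.
Proof.
move=> hq; rewrite [in LHS](mpolyE p) mulr_suml hcomp_sum.
rewrite [in RHS](mpolyE p) hcomp_sum mulr_suml; apply: eq_bigr => u _.
have hu : homogz (mdeg u)%:Z (p@_u *: 'X_[u] : R).
  apply/homogzP=> v; rewrite mcoeff_msupp mcoeffZ mcoeffX.
  by case: (u =P v) => [->|_]; rewrite // mulr0 eqxx.
rewrite (hcomp_homogz _ (homogzM hu hq)) (hcomp_homogz _ hu).
by rewrite (inj_eq (addIr e)); case: ifP; rewrite ?mul0r.
Qed.

Lemma homogz_coef0 d p : homogz d p -> d != 0 -> p@_0%MM = 0.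
Proof.
move=> /homogzP hp d0; apply/memN_msupp_eq0/negP => /hp.
by rewrite mdeg0 => dE; rewrite -dE in d0.
Qed.

End HomogeneousComponents.

(** * Matrices of degree-preserving maps *)

Section GradedMatrices.
Variables (k : fieldType) (m : nat).
Local Notation R := {mpoly k[m]}.

(** Generator s of the source has degree a s and generator t of the target has
    degree b t, so the entry (s, t) of a map of degree 0 has degree a s - b t. *)
Definition graded_mx r c (a : 'I_r -> int) (b : 'I_c -> int)
  (A : 'M[R]_(r, c)) : Prop := forall s t, homogz (a s - b t) (A s t).

Lemma graded_mxM r c e (a : 'I_r -> int) (b : 'I_c -> int) (d : 'I_e -> int)
    (A : 'M[R]_(r, c)) (B : 'M[R]_(c, e)) :
  graded_mx a b A -> graded_mx b d B -> graded_mx a d (A *m B).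
Proof.
move=> hA hB s t; rewrite mxE; apply: homogz_sum => u.
rewrite -(subrKA (b u)); exact: homogzM (hA s u) (hB u t).
Qed.

Lemma graded_mx_shift r c D (a : 'I_r -> int) (b : 'I_c -> int) A :
  graded_mx a b A -> graded_mx (fun s => a s + D) (fun t => b t + D) A.
Proof.
by move=> hA s t; rewrite opprD addrACA subrr addr0.
Qed.

Definition graded_part r c (a : 'I_r -> int) (b : 'I_c -> int)
  (A : 'M[R]_(r, c)) : 'M[R]_(r, c) := \matrix_(s, t) hcomp (a s - b t) (A s t).

Lemma graded_partP r c (a : 'I_r -> int) (b : 'I_c -> int) (A : 'M[R]_(r, c)) :
  graded_mx a b (graded_part a b A).
Proof. by move=> s t; rewrite mxE; apply: homogz_hcomp. Qed.

Lemma graded_part_id r c (a : 'I_r -> int) (b : 'I_c -> int)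
  (A : 'M[R]_(r, c)) : graded_mx a b A -> graded_part a b A = A.
Proof. by move=> hA; apply/matrixP=> s t; rewrite mxE hcomp_id. Qed.

Lemma graded_partM r c e (a : 'I_r -> int) (b : 'I_c -> int) (d : 'I_e -> int)
    (A : 'M[R]_(r, c)) (B : 'M[R]_(c, e)) :
  graded_mx b d B ->
  graded_part a d (A *m B) = graded_part a b A *m B.
Proof.
move=> hB; apply/matrixP=> s t; rewrite !mxE hcomp_sum; apply: eq_bigr => u _.
by rewrite mxE -(hcompM _ _ (hB u t)) subrKA.
Qed.

Lemma rows_lift (S : nzRingType) r c e (A : 'M[S]_(r, e)) (B : 'M[S]_(c, e)) :
  (forall s, exists w : 'rV_c, row s A = w *m B) -> exists X, A = X *m B.
Proof.
move/fin_all_exists=> [f fE]; exists (\matrix_s f s).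
by apply/row_matrixP=> s; rewrite row_mul rowK.
Qed.

(** Any lift may be replaced by its part of degree 0, because [A] is already
    homogeneous and taking the part commutes with [*m B]. *)
Lemma graded_lift r c e (a : 'I_r -> int) (b : 'I_c -> int) (d : 'I_e -> int)
    (A : 'M[R]_(r, e)) (B : 'M[R]_(c, e)) :
    graded_mx a d A -> graded_mx b d B ->
    (forall s, exists w : 'rV_c, row s A = w *m B) ->
  exists2 X, graded_mx a b X & A = X *m B.
Proof.
move=> hA hB /rows_lift[X AE]; exists (graded_part a b X).
  exact: graded_partP.
by rewrite -(graded_partM _ _ hB) -AE graded_part_id.
Qed.

End GradedMatrices.

(** * Comparison of graded free resolutions *)

Section Comparison.
Variables (k : fieldType) (m : nat).
Local Notation R := {mpoly k[m]}.
Implicit Types (F G K : free_seq k m) (I J L : R -> Prop).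

Record graded_ideal I : Prop := GradedIdeal {
  gidealD : forall p q, I p -> I q -> I (p + q);
  gidealM : forall c p, I p -> I (c * p);
  gideal_hcomp : forall d p, I p -> I (hcomp d p)
}.

Lemma diff_graded F I i :
  resolves F I -> graded_mx (@deg _ _ F i.+1) (@deg _ _ F i) (diff F i).
Proof. by move=> resF s t; apply: (diff_homog resF). Qed.

Lemma aug_graded F I : resolves F I -> graded_mx (@deg _ _ F 0) (fun=> 0) (aug F).
Proof. by move=> resF s t; rewrite ord1 subr0; apply: (aug_homog resF). Qed.

Lemma gidealN I p : graded_ideal I -> I p -> I (- p).
Proof. by move=> gI; rewrite -mulN1r; apply: gidealM. Qed.

Lemma gideal_sum I (T : Type) (r : seq T) (P : pred T) (f : T -> R) :
  graded_ideal I -> I 0 -> (forall t, I (f t)) -> I (\sum_(t <- r | P t) f t).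
Proof. by move=> gI I0 If; elim/big_ind: _ => //; apply: gidealD. Qed.

Lemma gideal0 F I : resolves F I -> I 0.
Proof.
move=> resF; have := exact_aug resF 0; rewrite mul0mx mxE => -[_ h].
by apply: h; exists 0; rewrite mul0mx.
Qed.

Lemma gideal_mulmx F I r (w : 'rV[R]_r) (A : 'cV[R]_r) :
  resolves F I -> graded_ideal I -> (forall t, I (A t 0)) -> I ((w *m A) 0 0).
Proof.
move=> resF gI IA; rewrite mxE; apply: gideal_sum => // [|t].
  exact: gideal0 resF.
exact: gidealM.
Qed.

Lemma diff_diff F I i : resolves F I -> diff F i.+1 *m diff F i = 0.
Proof.
move=> resF; apply/row_matrixP=> s; rewrite row0 row_mul.
by apply/(exact_diff resF); exists (delta_mx 0 s); rewrite -rowE.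
Qed.

Lemma diff_aug F I r (w : 'rV_r) (A : 'M_(r, _)) :
  resolves F I -> I ((w *m (A *m diff F 0) *m aug F) 0 0).
Proof. by move=> resF; apply/(exact_aug resF); exists (w *m A); rewrite mulmxA. Qed.

Lemma rows_diff F I i r (A : 'M_(r, rk F i.+1)) : resolves F I ->
  A *m diff F i = 0 -> forall s, exists w, row s A = w *m diff F i.+1.
Proof.
by move=> resF A0 s; apply/(exact_diff resF); rewrite -row_mul A0 row0.
Qed.

Lemma rows_aug F I r (A : 'M_(r, rk F 0)) : resolves F I ->
  (forall s, I ((A *m aug F) s 0)) -> forall s, exists w, row s A = w *m diff F 0.
Proof.
move=> resF hA s; apply/(exact_aug resF); move: (hA s); congr I.
by rewrite !mxE; apply: eq_bigr => t _; rewrite mxE.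
Qed.

(** Multiplication by g, which maps R/I to R/J and raises degrees by D, lifts to
    the resolutions. Each step lifts the rows of diff F i *m phi i through
    diff G i, which exactness of G allows. *)
Lemma comparison F G I J (g : R) (D : int) :
    resolves F I -> resolves G J -> graded_ideal J ->
    homogz D g -> (forall p, I p -> J (g * p)) ->
  exists phi : forall i, 'M[R]_(rk F i, rk G i),
    [/\ forall i, graded_mx (fun s => deg s + D) (@deg _ _ G i) (phi i),
        forall i, phi i.+1 *m diff G i = diff F i *m phi i
      & forall t, J ((phi 0%N *m aug G - g *: aug F) t 0)].
Proof.
move=> resF resG gJ hg IJ.
pose a i (s : 'I_(rk F i)) := deg s + D.
have augF_graded : graded_mx (@a 0%N) (fun=> 0) (g *: aug F).
  by move=> s t; rewrite mxE ord1 subr0 /a addrC; apply/homogzM/(aug_homog resF).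
have augG_graded := aug_graded resG.
(* The lift starts from arbitrary preimages of the g * aug F, made homogeneous;
   that the ideal is graded keeps the congruence modulo J. *)
have [phi0 phi0_graded phi0J] : exists2 phi0 : 'M[R]_(rk F 0, rk G 0),
    graded_mx (@a 0%N) (@deg _ _ G 0) phi0 &
    forall t, J ((phi0 *m aug G - g *: aug F) t 0).
  have [f fJ] := fin_all_exists (fun t => aug_surj resG ((g *: aug F) t 0)).
  exists (graded_part (@a 0%N) (@deg _ _ G 0) (\matrix_t f t)).
    exact: graded_partP.
  move=> t; rewrite -(graded_partM _ _ augG_graded).
  have := gidealN gJ (gideal_hcomp gJ (a 0%N t - 0) (fJ t)); congr J.
  rewrite hcompD hcompN opprD opprK.
  have -> : f t *m aug G = row t (\matrix_t f t *m aug G) by rewrite row_mul rowK.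
  rewrite -[in RHS](graded_part_id augF_graded).
  by rewrite [RHS]mxE addrC; congr (_ + _); rewrite !mxE.
(* The invariant must include that the next lifting problem is solvable. *)
pose Q i (phi : 'M[R]_(rk F i, rk G i)) := graded_mx (@a i) (@deg _ _ G i) phi
  /\ (forall s, exists w, row s (diff F i *m phi) = w *m diff G i).
have Q0 : Q 0%N phi0.
  split=> // s; apply: (rows_aug resG) => {}s.
  have -> : diff F 0 *m phi0 *m aug G =
      diff F 0 *m (phi0 *m aug G - g *: aug F) + g *: (diff F 0 *m aug F).
    by rewrite mulmxBr mulmxA scalemxAr subrK.
  rewrite mxE; apply: gidealD => //.
    have := gideal_mulmx (row s (diff F 0)) resG gJ phi0J; congr J.
    by rewrite -row_mul mxE.
  rewrite mxE; apply: IJ.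
  have := diff_aug (delta_mx 0 s) 1%:M resF; congr I.
  by rewrite mul1mx -rowE -row_mul mxE.
have step i phi : Q i phi ->
    exists2 phi', Q i.+1 phi' & phi' *m diff G i = diff F i *m phi.
  case=> [hphi lphi].
  have dphi_graded : graded_mx (@a i.+1) (@deg _ _ G i) (diff F i *m phi).
    exact: graded_mxM (graded_mx_shift D (diff_graded (i:=i) resF)) hphi.
  have [X hX XE] := graded_lift dphi_graded (diff_graded (i:=i) resG) lphi.
  exists X => //; split=> // s; apply: (rows_diff resG).
  by rewrite -mulmxA -XE mulmxA (diff_diff _ resF) mul0mx.
have [phi [phi0E Qphi cphi]] := dependent_choice Q0 step.
by exists phi; split=> // [i|]; [case: (Qphi i) | rewrite phi0E].
Qed.

(** The homotopy is built from left to right: h (i + 1) lifts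
    chi (i + 1) - diff i *m h i, which is a cycle because of the equation satisfied
    by h i. *)
Lemma null_homotopy F I (chi : forall i, 'M[R]_(rk F i)) :
    resolves F I ->
    (forall i, chi i.+1 *m diff F i = diff F i *m chi i) ->
    (forall t, I ((chi 0%N *m aug F) t 0)) ->
  exists h : forall i, 'M[R]_(rk F i, rk F i.+1),
    chi 0%N = h 0%N *m diff F 0 /\
    forall i, chi i.+1 = h i.+1 *m diff F i.+1 + diff F i *m h i.
Proof.
move=> resF chiE /(rows_aug resF)/rows_lift[h0 h0E].
pose Q i (h : 'M[R]_(rk F i, rk F i.+1)) :=
  (chi i.+1 - diff F i *m h) *m diff F i = 0.
(* The condition Q says that the next difference to be lifted is a cycle. *)
have Q0 : Q 0%N h0.
  by rewrite /Q mulmxBl chiE -mulmxA -h0E subrr.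
have step i h : Q i h -> exists2 h', Q i.+1 h' &
    chi i.+1 = h' *m diff F i.+1 + diff F i *m h.
  move=> /(rows_diff resF)/rows_lift[h' h'E]; exists h'; last first.
    by rewrite -h'E subrK.
  rewrite /Q mulmxBl chiE -mulmxA -mulmxBr -h'E opprB addrC subrK.
  by rewrite mulmxA (diff_diff _ resF) mul0mx.
have [h [hh0 _ hE]] := dependent_choice Q0 step.
by exists h; rewrite hh0.
Qed.

End Comparison.

(** * Tor computed by a minimal resolution *)

Section Tor.
Variables (k : fieldType) (m : nat).
Local Notation R := {mpoly k[m]}.
Implicit Types (F G : free_seq k m) (I : R -> Prop).

Definition mx_coef0 r c (A : 'M[R]_(r, c)) : 'M[k]_(r, c) := map_mx (mcoeff 0%MM) A.

Definition minimal F : Prop := forall i, kdiff F i = 0.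

Definition num_gens F i (j : int) : nat := \sum_(t < rk F i) (deg t == j).

Lemma mul_kdeg F i j r (A : 'M[k]_(r, rk F i)) s t :
  (A *m kdeg F i j) s t = A s t * (deg t == j)%:R.
Proof. by rewrite mul_mx_diag !mxE. Qed.

Lemma kdeg_mul F i j r (A : 'M[k]_(rk F i, r)) s t :
  (kdeg F i j *m A) s t = (deg s == j)%:R * A s t.
Proof. by rewrite mul_diag_mx !mxE. Qed.

Lemma kdeg_idem F i j : kdeg F i j *m kdeg F i j = kdeg F i j.
Proof.
apply/matrixP=> s t; rewrite mul_kdeg !mxE.
by case: (s =P t) => [->|_]; rewrite ?mul0r // mulr1n -natrM mulnb andbb.
Qed.

Lemma sub_kdegP F i j r (A : 'M[k]_(r, rk F i)) :
  (A <= kdeg F i j)%MS -> A *m kdeg F i j = A.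
Proof. by case/submxP=> X ->; rewrite -mulmxA kdeg_idem. Qed.

(** The diagonal 0-1 matrix has the same row space as the matrix E of the
    coordinate rows at the generators of degree j, which is row free. *)
Lemma rank_kdeg F i j : \rank (kdeg F i j) = num_gens F i j.
Proof.
pose S := [pred t : 'I_(rk F i) | deg t == j].
pose E : 'M[k]_(#|S|, rk F i) := rowsub (@enum_val _ S) 1%:M.
have E_free : row_free E.
  apply/row_freeP; exists E^T; apply/matrixP=> a b; rewrite !mxE.
  rewrite (bigD1 (enum_val a)) //= big1 => [|t]; rewrite !mxE.
    by rewrite eqxx mul1r addr0 eq_sym (inj_eq enum_val_inj).
  by rewrite eq_sym => /negbTE->; rewrite mul0r.
rewrite /num_gens -big_mkcond sum1_card -(eqP E_free).
apply/eqmx_rank/andP; split.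
  apply/row_subP=> t; have [St|St] := boolP (t \in S).
    apply/submxP; exists (delta_mx 0 (enum_rank_in St t)).
    rewrite -rowE; apply/rowP=> u; rewrite !mxE enum_rankK_in //.
    by move: St; rewrite inE => /eqP->; rewrite eqxx.
  rewrite (_ : row t _ = 0) ?sub0mx //; apply/rowP=> u; rewrite !mxE.
  by move: St; rewrite inE => /negbTE->; rewrite mul0rn.
apply/submxP; exists E; apply/matrixP=> a t; rewrite mul_kdeg !mxE.
case: eqP => [<-|]; rewrite ?mul0r //.
by have := enum_valP a; rewrite inE => ->; rewrite mulr1.
Qed.

(** After reduction modulo the variables only the entries of degree 0 survive. *)
Lemma graded_mx_kdeg F G i i' j (A : 'M[R]_(rk F i, rk G i')) :
  graded_mx (@deg _ _ F i) (@deg _ _ G i') A ->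
  kdeg F i j *m mx_coef0 A = mx_coef0 A *m kdeg G i' j.
Proof.
move=> hA; apply/matrixP=> s t; rewrite mul_kdeg kdeg_mul !mxE mulrC.
have [->//|ne] := eqVneq (deg s) (deg t).
by rewrite (homogz_coef0 (hA s t)) ?mul0r // subr_eq0.
Qed.

Lemma kdiff_kdeg F I i j : resolves F I ->
  kdeg F i.+1 j *m kdiff F i = kdiff F i *m kdeg F i j.
Proof. by move=> resF; apply/graded_mx_kdeg/diff_graded/resF. Qed.

Lemma sub_kcycles F i j r (A : 'M[k]_(r, rk F i.+1)) :
  (A <= kcycles F i.+1 j)%MS = (A <= kdeg F i.+1 j)%MS && (A *m kdiff F i == 0).
Proof. by rewrite sub_capmx; congr (_ && _); apply/sub_kermxP/eqP. Qed.

(** With G minimal, the homotopy on G vanishes modulo the variables, so the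
    comparison maps satisfy S *m P = 1 there: P maps the cycles of F in degree j
    onto the generators of G in degree j. The homotopy on F shows that the kernel
    of P on cycles consists of boundaries. Hence the two ranks in [tor_dim] differ
    by the number of generators. *)
Lemma tor_dim_minimal F G I i j : resolves F I -> resolves G I ->
  graded_ideal I -> minimal G -> tor_dim F i j = num_gens G i j.
Proof.
move=> resF resG gI minG.
have I_id p : I p -> I (1 * p) by rewrite mul1r.
have [phi [phi_gr phiE phi0]] := comparison resF resG gI (@homogz1 k m) I_id.
have [psi [psi_gr psiE psi0]] := comparison resG resF gI (@homogz1 k m) I_id.
have gr0 F1 F2 i1 i2 (A : 'M[R]_(rk F1 i1, rk F2 i2)) :
    graded_mx (fun s => deg s + 0) (@deg _ _ F2 i2) A ->
    graded_mx (@deg _ _ F1 i1) (@deg _ _ F2 i2) A.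
  by move=> hA s t; have := hA s t; rewrite addr0.
(* Both f and f' lift the identity of R/I, so 1 - f f' lifts 0. *)
have htpy F1 F2 (f : forall l, 'M[R]_(rk F1 l, rk F2 l)) f' :
    resolves F1 I ->
    (forall l, f l.+1 *m diff F2 l = diff F1 l *m f l) ->
    (forall l, f' l.+1 *m diff F1 l = diff F2 l *m f' l) ->
    (forall t, I ((f 0%N *m aug F2 - 1 *: aug F1) t 0)) ->
    (forall t, I ((f' 0%N *m aug F1 - 1 *: aug F2) t 0)) ->
  exists h : forall l, 'M[R]_(rk F1 l, rk F1 l.+1),
    1%:M - f 0%N *m f' 0%N = h 0%N *m diff F1 0 /\
    forall l, 1%:M - f l.+1 *m f' l.+1 = h l.+1 *m diff F1 l.+1 + diff F1 l *m h l.
  move=> res1 fE f'E f0 f'0.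
  apply: (null_homotopy (chi := fun l => 1%:M - f l *m f' l) res1) => [l|t].
    by rewrite mulmxBl mulmxBr mul1mx mulmx1 -mulmxA f'E !mulmxA fE.
  have -> : (1%:M - f 0%N *m f' 0%N) *m aug F1 =
      - (f 0%N *m (f' 0%N *m aug F1 - 1 *: aug F2)
         + (f 0%N *m aug F2 - 1 *: aug F1)).
    by rewrite !scale1r mulmxBl mul1mx mulmxBr mulmxA addrA subrK opprB.
  rewrite mxE; apply: gidealN => //; rewrite mxE; apply: gidealD => //.
  have := gideal_mulmx (row t (f 0%N)) res1 gI f'0; congr I.
  by rewrite -row_mul mxE.
have [hF [hF0 hFS]] := htpy _ _ phi psi resF phiE psiE phi0 psi0.
have [hG [hG0 hGS]] := htpy _ _ psi phi resG psiE phiE psi0 phi0.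
have kM r c e (A : 'M[R]_(r, c)) (B : 'M[R]_(c, e)) :
  mx_coef0 (A *m B) = mx_coef0 A *m mx_coef0 B by exact: map_mxM.
have kB r c (A B : 'M[R]_(r, c)) : mx_coef0 (A - B) = mx_coef0 A - mx_coef0 B.
  exact: map_mxB.
have kD r c (A B : 'M[R]_(r, c)) : mx_coef0 (A + B) = mx_coef0 A + mx_coef0 B.
  exact: map_mxD.
have k1 r : mx_coef0 (1%:M : 'M[R]_r) = 1%:M by exact: map_mx1.
pose P l := mx_coef0 (phi l); pose S l := mx_coef0 (psi l).
have PE l : P l.+1 *m kdiff G l = kdiff F l *m P l.
  by rewrite -[kdiff G l]/(mx_coef0 (diff G l)) -kM phiE kM.
have SE l : S l.+1 *m kdiff F l = kdiff G l *m S l.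
  by rewrite -[kdiff F l]/(mx_coef0 (diff F l)) -kM psiE kM.
(* Both terms of the homotopy contain a differential of G, which is 0 over k. *)
have SP l : S l *m P l = 1%:M.
  apply/eqP; rewrite -kM eq_sym -subr_eq0 -k1 -kB; apply/eqP.
  case: l => [|l]; first by rewrite hG0 kM [mx_coef0 (diff _ _)]minG mulmx0.
  by rewrite hGS kD !kM ![mx_coef0 (diff _ _)]minG mulmx0 mul0mx addr0.
have Pdeg l : kdeg F l j *m P l = P l *m kdeg G l j by apply/graded_mx_kdeg/gr0.
have Sdeg l : kdeg G l j *m S l = S l *m kdeg F l j by apply/graded_mx_kdeg/gr0.
have ddF l : kdiff F l.+1 *m kdiff F l = 0.
  by rewrite -kM (diff_diff _ resF) [LHS]map_mx0.
set Z := kcycles F i j.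
have ZE : (Z <= kdeg F i j)%MS by rewrite /Z; case: (i) => //= l; apply: capmxSl.
have SZ : (kdeg G i j *m S i <= Z)%MS.
  rewrite /Z; case: (i) => [|l] /=; first by rewrite Sdeg submxMl.
  rewrite sub_kcycles Sdeg submxMl /= -mulmxA (kdiff_kdeg _ _ resF) mulmxA SE.
  by rewrite minG !mul0mx.
have BZ : (kboundaries F i j <= Z)%MS.
  rewrite /kboundaries (kdiff_kdeg _ _ resF) /Z; case: (i) => [|l] /=.
    exact: submxMl.
  by rewrite sub_kcycles submxMl -(kdiff_kdeg _ _ resF) -mulmxA ddF mulmx0 /=.
have ZP : (Z *m P i :=: kdeg G i j)%MS.
  apply/eqmxP/andP; split.
    apply: submx_trans (submxMr _ ZE) _; rewrite Pdeg; exact: submxMl.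
  by have := submxMr (P i) SZ; rewrite -mulmxA SP mulmx1.
(* On a cycle killed by P, the identity 1 - PS = hd + dh reads V = V h d. *)
have htpyV l r (V : 'M_(r, rk F l)) : (V <= kcycles F l j)%MS ->
    V *m P l = 0 -> V = V *m mx_coef0 (hF l) *m kdiff F l.
  move=> VZ VP.
  have -> : V *m mx_coef0 (hF l) *m kdiff F l = V *m mx_coef0 (hF l *m diff F l).
    by rewrite kM mulmxA.
  rewrite -[LHS]mulmx1 -[1%:M](subrK (P l *m S l)) mulmxDr (mulmxA V (P l)) VP.
  rewrite mul0mx addr0 -kM -k1 -kB.
  case: l => [|l] in V VZ {VP} *; first by rewrite hF0.
  move: VZ; rewrite sub_kcycles => /andP[_ /eqP Vd].
  by rewrite hFS kD mulmxDr [X in _ + _ *m X]kM [X in _ + X]mulmxA Vd mul0mx addr0.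
have ZkerP : (Z :&: kermx (P i) :=: kboundaries F i j)%MS.
  apply/eqmxP/andP; split; last first.
    rewrite sub_capmx BZ; apply/sub_kermxP.
    by rewrite /kboundaries -mulmxA -PE minG !mulmx0.
  set V := (Z :&: kermx (P i))%MS.
  have VZ : (V <= Z)%MS by apply: capmxSl.
  have VP : V *m P i = 0 by apply/sub_kermxP/capmxSr.
  have Vdeg : V *m kdeg F i j = V by apply: sub_kdegP; apply: submx_trans VZ ZE.
  (* The homotopy may mix degrees; multiplying by kdeg removes the other ones. *)
  rewrite -Vdeg {1}(htpyV _ _ _ VZ VP) -mulmxA -(kdiff_kdeg _ _ resF).
  exact: submxMl.
rewrite /tor_dim -/Z -(mxrank_mul_ker Z (P i)) ZP ZkerP.
by rewrite addnK rank_kdeg.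
Qed.

(** The Betti table is stored as the numbers of generators of a minimal graded
    resolution, which is the form that mapping cones build on. *)
Definition has_betti I (b : nat -> int -> nat) : Prop :=
  exists F, [/\ resolves F I, minimal F & forall i j, num_gens F i j = b i j].

Lemma graded_betti_has I b i j :
  graded_ideal I -> has_betti I b -> graded_betti I i j (b i j).
Proof.
move=> gI [G [resG minG <-]]; split=> [|F resF]; first by exists G.
exact: tor_dim_minimal resG gI minG.
Qed.

End Tor.

(** * Mapping cones *)

Section MappingCone.
Variables (k : fieldType) (m : nat).
Local Notation R := {mpoly k[m]}.
Variables (F K : free_seq k m) (D : int).
Variable phi : forall i, 'M[R]_(rk K i, rk F i).

Definition cone_rk i : nat := if i is j.+1 then (rk F j.+1 + rk K j)%N else rk F 0.

Definition cone_deg i : 'I_(cone_rk i) -> int :=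
  match i with
  | 0 => @deg _ _ F 0
  | j.+1 => fun s => match split s with inl t => deg t | inr t => deg t + D end
  end.

Definition cone_diff i : 'M[R]_(cone_rk i.+1, cone_rk i) :=
  match i with
  | 0 => col_mx (diff F 0) (phi 0)
  | j.+1 => block_mx (diff F j.+1) 0 (phi j.+1) (- diff K j)
  end.

(** The index shift between F and K makes position 0 exceptional: there the cone
    is F 0 alone, augmented as F is. *)
Definition cone : free_seq k m := FreeSeq cone_deg cone_diff (aug F).

Lemma cone_deg_lshift i (s : 'I_(rk F i.+1)) :
  @cone_deg i.+1 (lshift (rk K i) s) = deg s.
Proof. by rewrite /cone_deg (unsplitK (inl s)). Qed.

Lemma cone_deg_rshift i (s : 'I_(rk K i)) :
  @cone_deg i.+1 (rshift (rk F i.+1) s) = deg s + D.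
Proof. by rewrite /cone_deg (unsplitK (inr s)). Qed.

Lemma num_gens_cone i e :
  num_gens cone i e =
  (num_gens F i e + (if i is j.+1 then num_gens K j (e - D) else 0))%N.
Proof.
case: i => [|i]; first by rewrite addn0.
rewrite /num_gens /= big_split_ord /=; congr (_ + _)%N; apply: eq_bigr => s _.
  by congr (nat_of_bool (_ == _)); apply: cone_deg_lshift.
rewrite -[deg s == _](inj_eq (addIr D)) subrK; congr (nat_of_bool (_ == _)).
exact: cone_deg_rshift.
Qed.

Hypothesis phi_graded :
  forall i, graded_mx (fun s => deg s + D) (@deg _ _ F i) (phi i).
Hypothesis phi_comm : forall i, phi i.+1 *m diff F i = diff K i *m phi i.

(** The differential of the cone consists of those of F and K and of phi, and an
    entry of phi of nonzero degree has no constant term. *)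
Lemma minimal_cone :
  minimal F -> minimal K ->
  (forall i (s : 'I_(rk K i)) (t : 'I_(rk F i)), deg s + D != deg t) ->
  minimal cone.
Proof.
move=> minF minK degD.
have phi0 i : map_mx (fun p : R => p@_0%MM) (phi i) = 0.
  apply/matrixP=> s t; rewrite !mxE; apply: homogz_coef0 (@phi_graded i s t) _.
  by rewrite subr_eq0.
case=> [|i]; rewrite /kdiff /=.
  by rewrite map_col_mx phi0 [map_mx _ _]minF col_mx0.
have minKN : mx_coef0 (- diff K i) = 0.
  by rewrite [LHS]map_mxN [map_mx _ _]minK oppr0.
have zero0 : mx_coef0 (0 : 'M[R]_(rk F i.+2, rk K i)) = 0 by apply: map_mx0.
rewrite map_block_mx phi0 [X in block_mx X]minF.
by rewrite [X in block_mx _ X]zero0 [X in block_mx _ _ _ X]minKN block_mx0.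
Qed.

Variables (I J L : R -> Prop) (g : R).
Hypotheses (resF : resolves F J) (resK : resolves K L) (idealJ : graded_ideal J).
Hypothesis colon : forall p, L p <-> J (g * p).
Hypothesis sum : forall p, I p <-> exists c, J (p - c * g).
Hypothesis phi_aug : forall t, J ((phi 0%N *m aug F - g *: aug K) t 0).

Lemma cone_augE r (b : 'rV[R]_r) (A : 'M_(r, _)) :
  J ((b *m (A *m phi 0%N) *m aug F) 0 0 - g * (b *m A *m aug K) 0 0).
Proof.
have := gideal_mulmx (b *m A) resF idealJ phi_aug; congr J.
by rewrite mulmxBr -scalemxAr !mulmxA !mxE.
Qed.

(** The long exact sequence of the cone, written out: R/L with degrees shifted by
    D injects into R/J by multiplication by g, with cokernel R/I, since L = J : g
    and I = J + (g). *)
Lemma resolves_cone : resolves cone I.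
Proof.
split.
- case=> [|i] s t /=.
    case: (split_ordP s) => s' ->; rewrite ?cone_deg_lshift ?cone_deg_rshift.
      by rewrite col_mxEu; apply: (diff_graded resF).
    by rewrite col_mxEd; apply: phi_graded.
  case: (split_ordP s) => s' ->; case: (split_ordP t) => t' ->;
    rewrite ?cone_deg_lshift ?cone_deg_rshift.
  + by rewrite block_mxEul; apply: (diff_graded resF).
  + by rewrite block_mxEur mxE; apply: homogz0.
  + by rewrite block_mxEdl; apply: phi_graded.
  rewrite block_mxEdr mxE; apply: homogzN.
  exact: (@graded_mx_shift _ _ _ _ D _ _ _ (diff_graded resK)).
- exact: aug_homog resF.
- move=> p; have [v Jv] := aug_surj resF p; exists v.
  by apply/sum; exists 0; rewrite mul0r subr0.
- move=> v; split=> [/sum[c Jc]|[w ->]] /=.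
    (* If c lifts to u in K 0, subtracting u *m phi 0 from v removes the multiple of
       g and leaves an element of J. *)
    have [u Lu] := aug_surj resK c.
    have : J (((v - u *m phi 0%N) *m aug F) 0 0).
      have := cone_augE u 1%:M; rewrite mul1mx mulmx1.
      move/(gidealN idealJ)/(gidealD idealJ)/(_ (iffLR (colon _) Lu)).
      move/(gidealD idealJ Jc); congr J.
      rewrite [cone.(aug)]/= mulmxBl [RHS]mxE [X in _ = _ + X]mxE; ring.
    move/(exact_aug resF)=> [w wE]; exists (row_mx w u).
    by rewrite mul_row_col -wE subrK.
  rewrite -[w]hsubmxK mul_row_col mulmxDl.
  set a := lsubmx w; set b := rsubmx w.
  apply/sum; exists ((b *m aug K) 0 0).
  rewrite [X in X - _]mxE -addrA; apply: gidealD => //.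
    by have := diff_aug a 1%:M resF; rewrite mul1mx.
  by have := cone_augE b 1%:M; rewrite mul1mx mulmx1 mulrC.
case=> [|i] v; rewrite -[v]hsubmxK; set a := lsubmx v; set b := rsubmx v;
  rewrite /= ?mul_row_block ?mul_row_col; split.
- move=> ab0.
  (* As b phi 0 = - a diff F 0, the element g (b aug K) lies in J, so b aug K lies
     in J : g = L. *)
  have /(exact_aug resK)[b' b'E] : L ((b *m aug K) 0 0).
    apply/colon; have := cone_augE b 1%:M; rewrite mul1mx mulmx1.
    move/(gidealN idealJ)/(gidealD idealJ); rewrite opprB.
    have bE : b *m phi 0%N = - (a *m diff F 0).
      by apply/eqP; rewrite -addr_eq0 addrC ab0.
    have := gidealN idealJ (diff_aug (a : 'rV_ _) 1%:M resF).
    rewrite mul1mx => Ja /(_ _ Ja); congr J.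
    by rewrite bE mulNmx [X in _ - X - _]mxE; ring.
  have /(exact_diff resF)[a' a'E] : (a + b' *m phi 1%N) *m diff F 0 = 0.
    by rewrite mulmxDl -mulmxA phi_comm mulmxA -b'E.
  exists (row_mx a' (- b')); rewrite mul_row_block mulmx0 add0r !mulNmx.
  by rewrite mulmxN opprK -b'E -a'E addrK.
- case=> w; rewrite -[w]hsubmxK mul_row_block; case/eq_row_mx=> -> ->.
  rewrite mulmx0 add0r mulmxDl -!mulmxA mulNmx -phi_comm (diff_diff _ resF).
  by rewrite mulmx0 add0r mulmxN subrr.
- rewrite mulmx0 add0r mulmxN -[0]row_mx0; case/eq_row_mx=> ab0 /eqP.
  rewrite oppr_eq0 => /eqP/(exact_diff resK)[b' b'E].
  have /(exact_diff resF)[a' a'E] : (a + b' *m phi i.+2) *m diff F i.+1 = 0.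
    by rewrite mulmxDl -mulmxA phi_comm mulmxA -b'E.
  exists (row_mx a' (- b')); rewrite mul_row_block mulmx0 add0r !mulNmx.
  by rewrite mulmxN opprK -b'E -a'E addrK.
- case=> w; rewrite -[w]hsubmxK mul_row_block; case/eq_row_mx=> -> ->.
  rewrite !mulmx0 !add0r mulmxDl -!mulmxA !(mulNmx, mulmxN) opprK -phi_comm.
  by rewrite (diff_diff _ resF) (diff_diff _ resK) !mulmx0 add0r subrr row_mx0.
Qed.

End MappingCone.

Lemma num_gens_deg (k : fieldType) m (F : free_seq k m) i (s : 'I_(rk F i)) :
  num_gens F i (deg s) != 0%N.
Proof. by rewrite /num_gens (bigD1 s) //= eqxx. Qed.

(** The condition on degrees says that no generator of the shifted K i has the
    same degree as one of F i, which forces the lift to be minimal. *)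
Lemma has_betti_cone (k : fieldType) m (I J L : {mpoly k[m]} -> Prop) g D bJ bL :
    graded_ideal J -> homogz D g ->
    (forall p, L p <-> J (g * p)) ->
    (forall p, I p <-> exists c, J (p - c * g)) ->
    has_betti J bJ -> has_betti L bL ->
    (forall i e e', bL i e' != 0%N -> bJ i e != 0%N -> e' + D != e) ->
  has_betti I (fun i e => bJ i e + (if i is j.+1 then bL j (e - D)%R else 0))%N.
Proof.
move=> gJ hg colon sum [F [resF minF numF]] [K [resK minK numK]] degD.
have LJ p : L p -> J (g * p) by move/colon.
have [phi [phi_gr phiE phi0]] := comparison resK resF gJ hg LJ.
exists (cone D phi); split.
- exact: resolves_cone resF resK gJ colon sum phi0.
- apply: minimal_cone => // i s t; apply: (degD i).
    by rewrite -numK num_gens_deg.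
  by rewrite -numF num_gens_deg.
by move=> i e; rewrite num_gens_cone numF; case: i => [|i]; rewrite ?numK.
Qed.

(** * Monomial ideals with linear quotients *)

Section MonomialIdeals.
Variables (k : fieldType) (m : nat).
Local Notation R := {mpoly k[m]}.
Implicit Types (P Q : pred 'X_{1..m}) (u v : 'X_{1..m}) (p : R).

Definition monomial_ideal P p : Prop := forall u, u \in msupp p -> P u.

Definition up_closed P : Prop := forall u v, P u -> P (u + v)%MM.

Lemma mono0 P : monomial_ideal P 0.
Proof. by move=> u; rewrite msupp0. Qed.

Lemma monoD P p q : monomial_ideal P p -> monomial_ideal P q -> monomial_ideal P (p + q).
Proof. by move=> Pp Pq u /msuppD_le; rewrite mem_cat => /orP[/Pp|/Pq]. Qed.

Lemma monoZX P (c : k) u : P u -> monomial_ideal P (c *: 'X_[u] : R).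
Proof. by move=> Pu v /msuppZ_le; rewrite msuppX inE => /eqP->. Qed.

Lemma mono_sum P (I : Type) (r : seq I) (A : pred I) (f : I -> R) :
  (forall i, A i -> monomial_ideal P (f i)) -> monomial_ideal P (\sum_(i <- r | A i) f i).
Proof. by move=> h; elim/big_ind: _ => //; [exact: mono0 | exact: monoD]. Qed.

Lemma mono_graded_ideal P : up_closed P -> graded_ideal (monomial_ideal P).
Proof.
move=> Pup; split=> [p q|c p Pp u|d p Pp u]; first exact: monoD.
  case/msuppM_le/allpairsP=> -[v w] /= [_ /Pp Pw ->].
  by rewrite addmC; apply: Pup.
by rewrite mcoeff_msupp mcoeff_hcomp; case: ifP => _; rewrite ?eqxx // -mcoeff_msupp => /Pp.
Qed.

Lemma mono_ext P Q p : P =1 Q -> monomial_ideal P p <-> monomial_ideal Q p.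
Proof. by move=> PQ; split=> h u /h; rewrite PQ. Qed.

(** Multiplication by X^u translates the support. *)
Lemma mono_colon P u p :
  monomial_ideal (fun v => P (u + v)%MM) p <-> monomial_ideal P ('X_[u] * p).
Proof.
rewrite mulrC; split=> h v.
  by rewrite (perm_mem (msuppMX p u)) => /mapP[w /h ? ->].
move=> v_p; apply: h; rewrite (perm_mem (msuppMX p u)).
by apply/mapP; exists v.
Qed.

(** The witness c collects the monomials of p outside P, divided by X^u. *)
Lemma mono_add P u p : up_closed P ->
  monomial_ideal (fun v => P v || (u <= v)%MM) p <->
  exists c, monomial_ideal P (p - c * 'X_[u]).
Proof.
move=> Pup; split=> [h|[c h] v v_p]; last first.
  rewrite -(subrK (c * 'X_[u]) p) in v_p.
  case/msuppD_le: v_p; rewrite mem_cat => /orP[/h->//|].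
  by rewrite (perm_mem (msuppMX c u)) => /mapP[w _ ->]; rewrite lem_addr orbT.
exists (\sum_(v <- msupp p | ~~ P v) p@_v *: 'X_[(v - u)%MM]).
rewrite {1}[p]mpolyE (bigID P) /= mulr_suml -addrA -sumrB.
rewrite [X in _ + X]big_seq_cond [X in _ + X]big1 ?addr0.
  by apply: mono_sum => v Pv; apply: monoZX.
move=> v /andP[/h + /negbTE Pv]; rewrite Pv /= => uv.
by rewrite -scalerAl -mpolyXD submK // subrr.
Qed.

Lemma has_betti_ext (I J : R -> Prop) b c :
    (forall p, I p <-> J p) -> (forall i e, b i e = c i e) ->
  has_betti I b -> has_betti J c.
Proof.
move=> IJ bc [F [[h1 h2 h3 h4 h5] minF numF]]; exists F; split=> //.
  split=> // [p|v]; last by rewrite -h4 IJ.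
  by have [v Iv] := h3 p; exists v; apply/IJ.
by move=> i e; rewrite numF.
Qed.

(** The table of R/I for a proper I: position 0 is one generator of degree 0, and
    c q lists the generators in position q + 1. *)
Definition quotient_betti (c : nat -> int -> nat) (i : nat) (e : int) : nat :=
  if i is q.+1 then c q e else (e == 0).

(** R resolves itself; its resolution has rank 1 in position 0 and rank 0
    elsewhere. *)
Lemma has_betti_zero :
  has_betti (monomial_ideal xpred0) (quotient_betti (fun _ _ => 0%N)).
Proof.
exists (@FreeSeq k m (fun i => (i == 0)%N) (fun _ _ => 0) (fun _ => 0) (const_mx 1)).
have mono_zero p : monomial_ideal xpred0 p <-> p = 0.
  split=> [h|->]; last exact: mono0.
  apply: msuppnil0; case E: (msupp p) => [//|u s].
  by have := h u; rewrite E mem_head => /(_ isT).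
have augE (v : 'rV[R]_1) : (v *m const_mx 1 : 'M_1) 0 0 = v 0 0.
  by rewrite mxE big_ord1 mxE mulr1.
split=> [||i e].
- split=> //= [i s|t|p|v|i v]; first by case: s.
  + by rewrite mxE; apply: homogz1.
  + by exists p%:M; rewrite augE mxE eqxx mulr1n subrr; apply: mono0.
  + rewrite augE mono_zero; split=> [v0|[w ->]]; last by rewrite mulmx0 mxE.
    by exists 0; rewrite mul0mx; apply/rowP=> t; rewrite !ord1 v0 mxE.
  split=> _; last by rewrite mulmx0.
  by exists 0; rewrite mul0mx; apply/rowP=> -[].
- by move=> i; apply/matrixP; case.
by rewrite /num_gens; case: i => [|i] /=; rewrite ?big_ord0 // big_ord1 eq_sym.
Qed.

(** When R/(P : u) has a linear resolution, its shifted generators in position q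
    have degree q + mdeg u, while those of R/P in that position have degree at most
    q - 1 + mdeg u. So the cone is minimal. *)
Lemma has_betti_colon P u c bL :
    up_closed P -> (0 < mdeg u)%N ->
    has_betti (monomial_ideal P) (quotient_betti c) ->
    has_betti (monomial_ideal (fun v => P (u + v)%MM)) bL ->
    (forall q e, c q e != 0%N -> e <= (q + mdeg u)%:Z) ->
    (forall q e, bL q e != 0%N -> e = q%:Z) ->
  has_betti (monomial_ideal (fun v => P v || (u <= v)%MM))
    (quotient_betti (fun q e => c q e + bL q (e - (mdeg u)%:Z)%R)%N).
Proof.
move=> Pup u0 hP hL degc degL.
have hcone := has_betti_cone (mono_graded_ideal Pup) (@homogzX k m u)
  (fun p => mono_colon P u p) (fun p => mono_add u p Pup) hP hL.
apply: has_betti_ext (hcone _) => // [[|i] e|i e e' bLi].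
- by rewrite /= addn0.
- by [].
rewrite (degL _ _ bLi); case: i {bLi} => [|i] /=; last by move/degc; lia.
by case: (e =P 0) => // ->; lia.
Qed.

Definition koszul_betti s (q : nat) (e : int) : nat := ((e == q%:Z) * 'C(s, q))%N.

Lemma koszul_betti_deg s q e : koszul_betti s q e != 0%N -> e = q%:Z.
Proof. by rewrite muln_eq0 negb_or eqb0 negbK => /andP[/eqP]. Qed.

(** Variables form a regular sequence: (Y) : y = (Y) for y outside Y, so the cone
    adds a copy of the table shifted by one, as in Pascal's rule. *)
Lemma koszul_has_betti (Y : seq 'I_m) : uniq Y ->
  has_betti (monomial_ideal (fun v => has (fun i => v i != 0%N) Y))
    (koszul_betti (size Y)).
Proof.
elim: Y => [|y Y IH] /= => [_|/andP[yY /IH{}IH]].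
  apply: has_betti_ext has_betti_zero => // -[|i] e.
    by rewrite /koszul_betti muln1.
  by rewrite /koszul_betti bin0n muln0.
have IHs : has_betti (monomial_ideal (fun v => has (fun i => v i != 0%N) Y))
    (quotient_betti (fun q => koszul_betti (size Y) q.+1)).
  by apply: has_betti_ext IH => // -[|i] e; rewrite /koszul_betti /= ?bin0 ?muln1.
have IHcolon : has_betti
    (monomial_ideal (fun v => has (fun i => (U_(y) + v)%MM i != 0%N) Y))
    (koszul_betti (size Y)).
  apply: has_betti_ext IH => // p; apply: mono_ext => v; apply: eq_in_has => i iY.
  by rewrite mnmDE mnm1E; case: (y =P i) iY yY => [->->|].
have := has_betti_colon _ _ IHs IHcolon; rewrite mdeg1.
move=> H; apply: has_betti_ext (H _ _ _ _) => //.
- by move=> p; apply: mono_ext => v; rewrite lep1mP orbC.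
- move=> [|i] e; rewrite /koszul_betti /=; first by rewrite bin0 muln1.
  by rewrite binS mulnDr subr_eq -PoszD addn1.
- move=> u v /hasP[i iY ui]; apply/hasP; exists i => //.
  by rewrite mnmDE addn_eq0 negb_and ui.
- by move=> q e /koszul_betti_deg->; lia.
exact: koszul_betti_deg.
Qed.

Lemma has_betti_add_gen P u (Y : seq 'I_m) c :
    up_closed P -> uniq Y -> (0 < mdeg u)%N ->
    (forall v, P (u + v)%MM = has (fun i => v i != 0%N) Y) ->
    (forall q e, c q e != 0%N -> e <= (q + mdeg u)%:Z) ->
    has_betti (monomial_ideal P) (quotient_betti c) ->
  has_betti (monomial_ideal (fun v => P v || (u <= v)%MM)) (quotient_betti
    (fun q e => c q e + (e == (q + mdeg u)%:Z) * 'C(size Y, q))%N).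
Proof.
move=> Pup uY u0 colon degc hP.
have hL : has_betti (monomial_ideal (fun v => P (u + v)%MM)) (koszul_betti (size Y)).
  apply: has_betti_ext (koszul_has_betti uY) => // p.
  by apply: mono_ext => v; rewrite colon.
apply: has_betti_ext (has_betti_colon Pup u0 hP hL degc _) => //.
  by move=> [|i] e //=; rewrite /koszul_betti subr_eq -PoszD.
exact: koszul_betti_deg.
Qed.

(** Induction on T. The last two conditions on T say that the colon ideal of each
    generator by P and the other ones is (Y), in whatever order they are added. *)
Lemma has_betti_add_gens P (T : seq 'X_{1..m}) D (Y : seq 'I_m) c :
    up_closed P -> uniq Y -> (0 < D)%N -> uniq T ->
    (forall f, f \in T -> mdeg f = D) ->
    (forall f v, f \in T -> P (f + v)%MM = has (fun i => v i != 0%N) Y) ->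
    (forall f f' v, f \in T -> f' \in T -> f' != f -> (f' <= f + v)%MM ->
      has (fun i => v i != 0%N) Y) ->
    (forall q e, c q e != 0%N -> e <= (q + D)%:Z) ->
    has_betti (monomial_ideal P) (quotient_betti c) ->
  has_betti (monomial_ideal (fun v => P v || has (fun f => (f <= v)%MM) T))
    (quotient_betti (fun q e => c q e + (e == (q + D)%:Z) * (size T * 'C(size Y, q)))%N).
Proof.
move=> Pup uY D0 + + + + degc hP; elim: T => [|f T IH] /=.
  move=> _ _ _ _; apply: has_betti_ext hP => [p|[|q] e] //=.
    by apply: mono_ext => v; rewrite orbF.
  by rewrite mul0n muln0 addn0.
move=> /andP[fT uT] degT colonT colonTT.
have TfT : {subset T <= f :: T} by move=> g gT; rewrite inE gT orbT.
have {}IH := IH uT (fun g gT => degT g (TfT g gT))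
  (fun g v gT => colonT g v (TfT g gT))
  (fun g g' v gT gT' => colonTT g g' v (TfT g gT) (TfT g' gT')).
have fD : mdeg f = D by apply: degT; rewrite mem_head.
have := has_betti_add_gen (u := f) _ uY _ _ _ IH; rewrite fD => H.
apply: has_betti_ext (H _ _ _ _) => //.
- by move=> p; apply: mono_ext => v; rewrite -orbA [has _ _ || _]orbC.
- by move=> [|q] e //=; rewrite -addnA mulSn mulnDr [X in (_ + X)%N]addnC.
- move=> u v /orP[/Pup->//|/hasP[g gT gu]]; apply/orP; right.
  by apply/hasP; exists g => //; apply: lepm_trans gu (lem_addr _ _).
- move=> v; rewrite colonT ?mem_head //; case: (boolP (has _ Y)) => //= nY.
  apply/negbTE/hasPn => g gT; apply: contra nY.
  apply: colonTT; rewrite ?mem_head ?TfT //.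
  by apply: contraTneq gT => ->.
by move=> q e; case: (eqVneq e (q + D)%:Z) => [->//|_]; rewrite mul0n addn0 => /degc.
Qed.

End MonomialIdeals.

(** * Monomials in a subset of the variables *)

Section PartialDegree.
Variable m : nat.
Implicit Types (Y : seq 'I_m) (u v f : 'X_{1..m}).

Definition degree_in Y v : nat := \sum_(i <- Y) v i.

Lemma degree_inD Y u v : degree_in Y (u + v)%MM = (degree_in Y u + degree_in Y v)%N.
Proof. by rewrite /degree_in -big_split; apply: eq_bigr => i _; rewrite mnmDE. Qed.

Lemma degree_in_gt0 Y v : (0 < degree_in Y v)%N = has (fun i => v i != 0%N) Y.
Proof.
elim: Y => [|y Y IH] /=; first by rewrite /degree_in big_nil.
by rewrite -IH /degree_in big_cons addn_gt0 lt0n.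
Qed.

Lemma leq_degree_in Y u v : (u <= v)%MM -> (degree_in Y u <= degree_in Y v)%N.
Proof. by move/mnm_lepP=> uv; apply: leq_sum => i _. Qed.

Lemma degree_in_supp Y f : uniq Y -> (forall i, i \notin Y -> f i = 0%N) ->
  degree_in Y f = mdeg f.
Proof.
move=> uY fY; rewrite mdegE (bigID (mem Y)) /= [X in (_ + X)%N]big1 ?addn0 //.
by rewrite /degree_in big_uniq.
Qed.

Lemma degree_in0 Y f : (forall i, i \in Y -> f i = 0%N) -> degree_in Y f = 0%N.
Proof. by move=> fY; rewrite /degree_in big1_seq // => i /andP[_ /fY]. Qed.

(** The two recursive calls are the two cases of Pascal's rule: y does not occur,
    or it occurs and one factor y is removed. *)
Fixpoint monomials Y : nat -> seq 'X_{1..m} :=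
  match Y with
  | [::] => fun d => if d is 0 then [:: 0%MM] else [::]
  | y :: Z => fix go d :=
      monomials Z d ++
      (if d is d'.+1 then [seq (U_(y) + f)%MM | f <- go d'] else [::])
  end.

Lemma monomials_consS y Y d : monomials (y :: Y) d.+1 =
  monomials Y d.+1 ++ [seq (U_(y) + f)%MM | f <- monomials (y :: Y) d].
Proof. by []. Qed.

Lemma monomials_cons0 y Y : monomials (y :: Y) 0 = monomials Y 0.
Proof. exact: cats0. Qed.

Lemma mem_monomials Y d f :
  (f \in monomials Y d) <-> mdeg f = d /\ (forall i, i \notin Y -> f i = 0%N).
Proof.
elim: Y d f => [|y Y IHY] d f.
  case: d => [|d] /=; last first.
    split=> // -[fd f0]; have : f = 0%MM by apply/mnmP => i; rewrite f0 ?mnm0E.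
    by move=> fE; rewrite fE mdeg0 in fd.
  rewrite inE; split=> [/eqP->|[_ f0]].
    by rewrite mdeg0; split=> // i _; rewrite mnm0E.
  by apply/eqP/mnmP=> i; rewrite f0 ?mnm0E.
elim: d f => [|d IHd] f.
  rewrite monomials_cons0 IHY; split=> -[fd f0]; split=> // i.
    by rewrite inE negb_or => /andP[_ /f0].
  by move=> _; have /eqP := fd; rewrite mdeg_eq0 => /eqP->; rewrite mnm0E.
rewrite monomials_consS mem_cat; split=> [/orP[/IHY[fd f0]|/mapP[g]]|[fd f0]].
- by split=> // i; rewrite inE negb_or => /andP[_ /f0].
- move=> /IHd[gd g0] ->; rewrite mdegD mdeg1 gd; split=> // i i_out.
  rewrite mnmDE g0 // mnm1E addn0; case: (y =P i) i_out => // ->.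
  by rewrite mem_head.
case: (eqVneq (f y) 0%N) => [fy|fy]; apply/orP; [left | right].
  apply/IHY; split=> // i iY; case: (eqVneq i y) => [->//|iy].
  by apply: f0; rewrite inE negb_or iy.
have Uf : (U_(y) <= f)%MM by rewrite lep1mP.
apply/mapP; exists (f - U_(y))%MM; last by rewrite addmC submK.
apply/IHd; split=> [|i /f0 fi]; last by rewrite mnmBE fi.
by apply/eqP; rewrite -(eqn_add2r 1) -[in X in (_ + X)%N](mdeg1 y) -mdegD submK // fd addn1.
Qed.

Lemma monomials_uniq Y d : uniq Y -> uniq (monomials Y d).
Proof.
elim: Y d => [|y Y IHY] d /=; first by case: d.
move=> /andP[yY /IHY{}IHY]; elim: d => [|d IHd]; first by rewrite cats0.
rewrite cat_uniq IHY map_inj_uniq ?IHd; last by move=> ? ? /addmI.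
rewrite andbT /=; apply/hasPn => _ /mapP[f _ ->]; apply/negP.
by move/mem_monomials=> [_ /(_ y yY)]; rewrite mnmDE mnm1E eqxx.
Qed.

(** The truncated subtraction gives the right count without variables as well: one
    monomial in degree 0 and none in positive degree. *)
Lemma size_monomials Y d : size (monomials Y d) = 'C(d + size Y - 1, d).
Proof.
elim: Y d => [|y Y IHY] d /=.
  by case: d => [|d] //=; rewrite addn0 subn1 bin_small.
elim: d => [|d IHd]; first by rewrite cats0 IHY !bin0.
rewrite size_cat size_map IHY IHd !addnS !subn1 /= !addSn /= -binS.
by [].
Qed.

(** Grow f one variable at a time: as long as its degree is less than the Y-degree
    of v, some exponent in Y is not yet exhausted. *)
Lemma exists_monomial Y d v : uniq Y -> (d <= degree_in Y v)%N ->
  exists2 f, f \in monomials Y d & (f <= v)%MM.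
Proof.
move=> uY; elim: d => [_|d IH dv].
  exists 0%MM; last by apply/mnm_lepP=> i; rewrite mnm0E.
  by apply/mem_monomials; split=> [|i _]; rewrite ?mdeg0 ?mnm0E.
have [f /mem_monomials[fd f0] fv] := IH (ltnW dv).
have /hasP[i iY fi] : has (fun i => (f i < v i)%N) Y.
  apply: contraLR dv => /hasPn vf; rewrite -leqNgt -fd -(degree_in_supp uY f0).
  rewrite /degree_in big_seq [leqRHS]big_seq.
  by apply: leq_sum => i iY; rewrite leqNgt vf.
exists (U_(i) + f)%MM.
  apply/mem_monomials; rewrite mdegD mdeg1 fd; split=> // j jY.
  by rewrite mnmDE f0 // mnm1E addn0; case: (i =P j) jY => // <-; rewrite iY.
apply/mnm_lepP=> j; rewrite mnmDE mnm1E; case: (i =P j) => [<-//|_].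
exact: (mnm_lepP fv).
Qed.

End PartialDegree.

(** * Adding generators layer by layer *)

Section Tower.
Variables (k : fieldType) (m : nat) (Y : seq 'I_m) (g : nat -> 'X_{1..m}) (a : nat).
Hypothesis uY : uniq Y.
Hypothesis gY : forall d i, i \in Y -> g d i = 0%N.
Hypothesis g_anti : forall d, (g d.+1 <= g d)%MM.
Hypothesis g_strict : forall d, (d < a)%N -> (mdeg (g d.+1) < mdeg (g d))%N.
Hypothesis a_gt0 : (0 < a)%N.

(** For a decreasing chain g, this is the ideal generated by the g d y^f with f of
    degree d in Y and d >= e. *)
Definition tower (e : nat) (v : 'X_{1..m}) : bool :=
  (e <= degree_in Y v)%N && (g (degree_in Y v) <= v)%MM.

Lemma g_antiW d d' : (d <= d')%N -> (g d' <= g d)%MM.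
Proof.
move/subnKC <-; elim: (d' - d)%N => [|t IH]; first by rewrite addn0 lepm_refl.
by rewrite addnS; apply: lepm_trans (g_anti _) IH.
Qed.

Lemma tower_up_closed e : up_closed (tower e).
Proof.
move=> u v /andP[eu gu]; rewrite /tower degree_inD (leq_trans eu) ?leq_addr //=.
by apply: lepm_trans (g_antiW (leq_addr _ _)) (lepm_trans gu (lem_addr _ _)).
Qed.

Lemma degree_in_gen d f v : f \in monomials Y d ->
  degree_in Y (g d + f + v)%MM = (d + degree_in Y v)%N.
Proof.
case/mem_monomials=> fd f0; rewrite !degree_inD (degree_in_supp uY f0) fd degree_in0 //.
exact: gY.
Qed.

(** A monomial v of Y-degree larger than e that is divisible by g e is divisible
    by g (degree_in Y v) too, so only Y-degree e brings in new monomials. *)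
Lemma towerS e v : tower e v =
  tower e.+1 v || has (fun h => h <= v)%MM [seq (g e + f)%MM | f <- monomials Y e].
Proof.
have -> : has (fun h => h <= v)%MM [seq (g e + f)%MM | f <- monomials Y e]
    = (g e <= v)%MM && (e <= degree_in Y v)%N.
  apply/hasP/andP=> [[_ /mapP[f fe ->] fv]|[gv ev]].
    split; first exact: lepm_trans (lem_addr _ _) fv.
    have := leq_degree_in Y fv.
    by have := degree_in_gen 0%MM fe; rewrite addm0 => ->; apply: leq_trans (leq_addr _ _).
  have [f fe fv] := exists_monomial uY ev; exists (g e + f)%MM.
    by apply/mapP; exists f.
  have [_ f0] := iffLR (mem_monomials _ _ _) fe.
  apply/mnm_lepP=> i; rewrite mnmDE; have [iY|/f0->] := boolP (i \in Y).
    by rewrite gY //; apply: (mnm_lepP fv).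
  by rewrite addn0; apply: (mnm_lepP gv).
rewrite /tower; case: (ltngtP e (degree_in Y v)) => [ev|_|ev] /=; rewrite ?andbF ?andbT //.
  case gv: (g e <= v)%MM; rewrite ?orbF ?orbT //.
  by apply: lepm_trans gv; apply/g_antiW/ltnW.
by rewrite ev.
Qed.

(** The contribution of the 'C(d + size Y - 1, d) generators g d y^f, each with a
    Koszul complex on Y. *)
Definition layer_betti d (q : nat) (e : int) : nat :=
  ((e == (q + (mdeg (g d) + d))%:Z) * ('C(d + size Y - 1, d) * 'C(size Y, q)))%N.

(** Layers are added from d = a - 1 down to d = a - t. In layer d the colon ideal
    of g d y^f is (Y): a factor in Y leads into layer d + 1, while a multiple by a
    monomial free of Y has Y-degree d, so it is in no earlier layer, and is
    divisible by no other g d y^f' with f' of degree d. *)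
Lemma has_betti_tower c t : (t <= a)%N ->
    (forall q e, c q e != 0%N -> e <= (q + (mdeg (g a) + a))%:Z) ->
    has_betti (@monomial_ideal k m (tower a)) (quotient_betti c) ->
  has_betti (@monomial_ideal k m (tower (a - t))) (quotient_betti
    (fun q e => c q e + \sum_(a - t <= d < a) layer_betti d q e)%N).
Proof.
move=> ta degc hP; elim: t ta => [|t IH] ta.
  rewrite subn0; apply: has_betti_ext hP => // -[|q] e //=.
  by rewrite big_geq ?addn0.
set e0 := (a - t.+1)%N; have e0E : (a - t)%N = e0.+1 by rewrite /e0; lia.
have e0a : (e0 < a)%N by rewrite /e0; lia.
(* Since mdeg (g d) decreases strictly, the degrees mdeg (g d) + d of the
   generators are nonincreasing in d, so adding larger layers first respects the
   order by degree. *)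
have mdegW d d' : (d <= d')%N -> (d' <= a)%N -> (mdeg (g d') + d' <= mdeg (g d) + d)%N.
  move/subnKC <-; elim: (d' - d)%N => [|s IHs]; first by rewrite addn0.
  rewrite addnS => sa; apply: leq_trans (IHs (ltnW sa)).
  by have := g_strict sa; lia.
have {}IH := IH (ltnW ta); rewrite e0E in IH.
pose T := [seq (g e0 + f)%MM | f <- monomials Y e0].
have TE v : tower e0.+1 v || has (fun h => h <= v)%MM T = tower e0 v.
  by rewrite [RHS]towerS.
have := has_betti_add_gens (T := T) (D := (mdeg (g e0) + e0)%N) (@tower_up_closed _) uY
  _ _ _ _ _ _ IH => H.
apply: has_betti_ext (H _ _ _ _ _ _).
- by move=> p; apply: mono_ext.
- move=> [|q] e //=; rewrite size_map size_monomials.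
  by rewrite [in RHS]big_ltn // [RHS]addnCA [RHS]addnC.
- have := mdegW e0 a (ltnW e0a) (leqnn _); lia.
- by rewrite map_inj_uniq ?monomials_uniq // => ? ? /addmI.
- by move=> _ /mapP[f /mem_monomials[fd _] ->]; rewrite mdegD fd.
- move=> _ v /mapP[f fe ->]; rewrite /tower degree_in_gen // -degree_in_gt0.
  rewrite -addn1 leq_add2l; case: (posnP (degree_in Y v)) => //= _.
  apply: lepm_trans (g_antiW (leq_addr _ _)) _.
  by rewrite -addmA lem_addr.
- move=> _ _ v /mapP[f fe ->] /mapP[f' fe' ->]; rewrite eqm_add2l => ff' le.
  apply: contraNT ff' => /hasPn v0.
  have [fd f0] := iffLR (mem_monomials _ _ _) fe.
  have [fd' f0'] := iffLR (mem_monomials _ _ _) fe'.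
  have ff' : (f' <= f)%MM.
    apply/mnm_lepP=> i; have [iY|/f0'->//] := boolP (i \in Y).
    have := mnm_lepP le i; rewrite !mnmDE; have := v0 i iY; lia.
  have := congr1 (@mdeg _) (submK ff'); rewrite mdegD fd fd' => /eqP.
  rewrite -[X in _ == X]add0n eqn_add2r mdeg_eq0 => /eqP ff0.
  by rewrite -(submK ff') ff0 add0m.
move=> q e; rewrite addn_eq0 negb_and => /orP[/degc e_le|].
  by have := mdegW e0 a (ltnW e0a) (leqnn _); lia.
rewrite sum_nat_seq_neq0 => /hasP[d]; rewrite mem_index_iota => /andP[d1 d2].
rewrite muln_eq0 negb_or eqb0 negbK => /andP[_ /andP[/eqP-> _]].
by have := mdegW e0 d (ltnW d1) (ltnW d2); lia.
Qed.

End Tower.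

(** * Powers of an ideal of variables *)

Lemma sum_bin_monomials N a : (0 < a)%N ->
  (\sum_(0 <= d < a) 'C(d + N - 1, d) = 'C(a + N - 1, N))%N.
Proof.
case: a => // a _; elim: a => [|a IH].
  by rewrite big_nat1 bin0 add1n subn1 binn.
rewrite big_nat_recr //= IH; case: N {IH} => [|N].
  by rewrite !bin0 addn0 subn1 bin_small.
rewrite !addnS !subn1 /= [in RHS]addSn binS; congr (_ + _)%N.
by have := bin_sub (leq_addl a.+1 N); rewrite addnK.
Qed.

(** For q <= N both sides are (a + N - 1)! / ((a - 1)! q! (N - q)!), and for
    q > N they vanish. *)
Lemma bin_trinomial N a q : (0 < a)%N ->
  ('C(a + N - 1, N) * 'C(N, q) = 'C(a + N - 1, a + q - 1) * 'C(a + q - 1, q))%N.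
Proof.
case: a => // a _; rewrite !addSn !subn1 /=.
case: (leqP q N) => [qN|Nq]; last first.
  by rewrite (bin_small Nq) muln0 [X in (X * _)%N]bin_small ?ltn_add2l.
(* Here a stands for the former a - 1; clearing denominators gives (a + N)! on
   both sides. *)
apply/eqP; rewrite -(eqn_pmul2r (fact_gt0 a)) -(eqn_pmul2r (fact_gt0 q)).
rewrite -(eqn_pmul2r (fact_gt0 (N - q))); apply/eqP.
have e1 := bin_fact (leq_addl a N); rewrite addnK in e1.
have e2 := bin_fact qN.
have e3 : ('C(a + N, a + q) * ((a + q)`! * (N - q)`!) = (a + N)`!)%N.
  by rewrite -[in RHS](bin_fact (leq_add (leqnn a) qN)) subnDl.
have e4 := bin_fact (leq_addl a q); rewrite addnK in e4.
transitivity ((a + N)`!).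
  by rewrite -e1 -e2; ring.
by rewrite -e3 -e4; ring.
Qed.

Lemma bin_power_step N a q : (0 < a)%N ->
  ('C(a + N - 1, a + q) * 'C(a + q - 1, q)
   + \sum_(0 <= d < a) 'C(d + N - 1, d) * 'C(N, q)
   = 'C(a + N, a + q) * 'C(a + q - 1, q))%N.
Proof.
move=> a0; rewrite -big_distrl /= sum_bin_monomials // bin_trinomial //.
rewrite -mulnDl; congr (_ * _)%N.
by case: a a0 => // a _; rewrite !addSn !subn1 /= binS.
Qed.

Section PowersOfVariables.
Variables (k : fieldType) (m : nat).

(** The table of the ideal generated by all monomials of degree a in s variables,
    whose resolution is linear. *)
Definition power_betti s a (q : nat) (e : int) : nat :=
  ((e == (q + a)%:Z) * ('C(a + s - 1, a + q) * 'C(a + q - 1, q)))%N.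

(** Induction on Y, with the chain g d = z^(a - d): a monomial v with Y-degree d
    has degree at least a in (Y, z) exactly when z^(a - d) divides it. All layers
    have degree a. *)
Lemma has_betti_power (Y : seq 'I_m) a : uniq Y -> (0 < a)%N ->
  has_betti (@monomial_ideal k m (fun v => a <= degree_in Y v)%N)
    (quotient_betti (power_betti (size Y) a)).
Proof.
move=> + a0; elim: Y => [_|z Y IH /= /andP[zY uY]].
  apply: has_betti_ext (has_betti_zero k m) => [p|[|q] e] //=.
    by apply: mono_ext => v; rewrite /degree_in big_nil leqNgt a0.
  rewrite /power_betti (_ : 'C(_, a + q) = 0%N) ?muln0 //.
  by apply: bin_small; lia.
pose g d := (U_(z) *+ (a - d))%MM : 'X_{1..m}.
have gE d i : g d i = ((z == i) * (a - d))%N by rewrite mulmnE mnm1E.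
have gdeg d : mdeg (g d) = (a - d)%N by rewrite mdegMn mdeg1 mul1n.
have gY d i : i \in Y -> g d i = 0%N.
  by move=> iY; rewrite gE; case: (z =P i) iY zY => [<-->|].
have g_anti d : (g d.+1 <= g d)%MM.
  by apply/mnm_lepP=> i; rewrite !gE leq_mul2l leq_sub2l ?orbT.
have g_strict d : (d < a)%N -> (mdeg (g d.+1) < mdeg (g d))%N.
  by rewrite !gdeg => da; rewrite ltn_sub2l.
have base : has_betti (@monomial_ideal k m (tower Y g a))
    (quotient_betti (power_betti (size Y) a)).
  apply: has_betti_ext (IH uY) => // p; apply: mono_ext => v.
  rewrite /tower; case: leqP => //= av; apply/esym/mnm_lepP=> i.
  by rewrite gE (eqP av) muln0.
have degc q e : power_betti (size Y) a q e != 0%N -> e <= (q + (mdeg (g a) + a))%:Z.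
  by rewrite muln_eq0 negb_or eqb0 negbK => /andP[/eqP-> _]; rewrite gdeg; lia.
have := has_betti_tower uY gY g_anti g_strict a0 (leqnn a) degc base.
rewrite subnn; apply: has_betti_ext => [p|[|q] e] //=.
  apply: mono_ext => v; rewrite /tower [degree_in (z :: Y) v]big_cons -/(degree_in Y v) /=.
  apply/mnm_lepP/idP=> [/(_ z)|vz i]; rewrite gE.
    by rewrite eqxx mul1n leq_subLR addnC.
  by case: (z =P i) => [<-|//]; rewrite mul1n leq_subLR addnC.
have sE : (a + (size Y).+1 - 1 = a + size Y)%N by lia.
rewrite /power_betti /= sE -bin_power_step // mulnDr; congr (_ + _)%N.
rewrite big_distrr /=; apply: eq_big_nat => d /andP[_ da].
by rewrite /layer_betti gdeg subnK // ltnW.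
Qed.

End PowersOfVariables.

(** * Two fat points *)

Section PointPowers.
Variables (k : fieldType) (n : nat).
Local Notation R := {mpoly k[n.+1]}.

(** The degree in the variables that vanish at the coordinate point c. *)
Definition degree_off (c : nat) (v : 'X_{1..n.+1}) : nat :=
  \sum_(i < n.+1 | (i : nat) != c) v i.

Lemma degree_offD c u v : degree_off c (u + v)%MM = (degree_off c u + degree_off c v)%N.
Proof. by rewrite /degree_off -big_split; apply: eq_bigr => i _; rewrite mnmDE. Qed.

Lemma degree_off_gt0 (c : nat) (v : 'X_{1..n.+1}) :
  reflect (exists2 i : 'I_n.+1, (i : nat) != c & v i != 0%N) (0 < degree_off c v)%N.
Proof.
rewrite lt0n sum_nat_eq0 negb_forall; apply: (iffP existsP) => -[i].
  by rewrite negb_imply => /andP[ic vi]; exists i.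
by move=> ic vi; exists i; rewrite negb_imply ic.
Qed.

Lemma degree_off_up_closed c a : up_closed (fun v => a <= degree_off c v)%N.
Proof. by move=> u v; rewrite degree_offD => /leq_trans; apply; apply: leq_addr. Qed.

(** It is enough to check generators, as the monomials in P span an ideal. *)
Lemma ideal_gen_mono (S : R -> Prop) (P : pred 'X_{1..n.+1}) p :
  up_closed P -> (forall f, S f -> monomial_ideal P f) -> ideal_gen S p ->
  monomial_ideal P p.
Proof.
move=> Pup SP [s sS ->]; rewrite big_seq; apply: mono_sum => u /sS/SP u2P.
exact: (gidealM (mono_graded_ideal k Pup)) u2P.
Qed.

Lemma mono_ideal_gen (S : R -> Prop) (P : pred 'X_{1..n.+1}) p :
  (forall v, P v -> S 'X_[v]) -> monomial_ideal P p -> ideal_gen S p.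
Proof.
move=> PS Pp; exists [seq ((p@_v)%:MP, 'X_[v]) | v <- msupp p].
  by move=> _ /mapP[v /Pp/PS Sv ->].
by rewrite big_map [LHS]mpolyE; apply: eq_bigr => v _; rewrite mul_mpolyC.
Qed.

Lemma ideal_pow_point c a (p : R) :
  ideal_pow (point_ideal (k := k) (n := n) c) a p <->
  monomial_ideal (fun v => a <= degree_off c v)%N p.
Proof.
elim: a p => [|a IH] p; first by split.
split=> [|pP].
  apply: ideal_gen_mono (@degree_off_up_closed c a.+1) _ => _ [f [h [If /IH hP ->]]].
  have fP : monomial_ideal (fun v => 1 <= degree_off c v)%N f.
    apply: ideal_gen_mono (@degree_off_up_closed c 1) _ If => _ [i ic ->] v.
    rewrite msuppX inE => /eqP->; apply/degree_off_gt0; exists i => //.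
    by rewrite mnm1E eqxx.
  move=> v /msuppM_le/allpairsP[[v1 v2] /= [/fP v1P /hP v2P ->]].
  by rewrite degree_offD -add1n leq_add.
apply: mono_ideal_gen pP => v v_gt.
have /degree_off_gt0[i ic vi] : (0 < degree_off c v)%N by apply: leq_trans v_gt.
exists 'X_i, 'X_[(v - U_(i))%MM]; split.
- exists [:: (1, 'X_i)]; last by rewrite big_seq1 mul1r.
  by move=> u; rewrite inE => /eqP->; exists i.
- apply/IH => w; rewrite msuppX inE => /eqP->.
  rewrite -(leq_add2l (degree_off c U_(i)%MM)) -degree_offD addmC submK ?lep1mP //.
  apply: leq_trans v_gt; rewrite -[leqRHS]add1n leq_add2r.
  rewrite /degree_off (bigD1 i) //= big1 ?addn0 ?mnm1E ?eqxx // => j /andP[_ ji].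
  by rewrite mnm1E eq_sym (negbTE ji).
by rewrite -mpolyXD addmC submK // lep1mP.
Qed.

Hypothesis n_ge2 : (2 <= n)%N.

Definition other_vars : seq 'I_n.+1 := [seq i : 'I_n.+1 <- enum 'I_n.+1 | (1 < i)%N].

Let x0 : 'I_n.+1 := ord0.
Let x1 : 'I_n.+1 := inord 1.

Lemma x1E : x1 = 1%N :> nat.
Proof. by rewrite inordK // ltnS ltnW. Qed.

Lemma mem_other_vars i : (i \in other_vars) = (1 < i)%N.
Proof. by rewrite mem_filter mem_enum andbT. Qed.

Lemma other_vars_uniq : uniq other_vars.
Proof. by rewrite filter_uniq ?enum_uniq. Qed.

Lemma size_other_vars : size other_vars = (n - 1)%N.
Proof.
rewrite size_filter -(count_map _ (fun i => 1 < i)%N) val_enum_ord.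
have -> : n.+1 = (2 + (n - 1))%N by lia.
rewrite iotaD count_cat /= !add0n; apply: etrans (size_iota 2 _).
by apply/eqP; rewrite -all_count; apply/allP=> i; rewrite mem_iota => /andP[].
Qed.

Lemma degree_off_other c (i : 'I_n.+1) v : (c < 2)%N -> (i < 2)%N -> (i : nat) != c ->
  degree_off c v = (v i + degree_in other_vars v)%N.
Proof.
move=> c2 i2 ic; rewrite /degree_off (bigD1 i) //=; congr (_ + _)%N.
rewrite /degree_in big_filter big_enum_cond /=; apply: eq_bigl => j.
by rewrite -val_eqE /=; lia.
Qed.

Lemma two_fat_pointsP a0 a1 (p : R) : two_fat_points k n a0 a1 p <->
  monomial_ideal (fun v => (a0 <= v x1 + degree_in other_vars v)
                 && (a1 <= v x0 + degree_in other_vars v))%N p.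
Proof.
rewrite /two_fat_points /ideal_cap !ideal_pow_point; split=> [[h0 h1] v vp|h].
  by rewrite -(degree_off_other (c := 0)) ?x1E // h0 // -(degree_off_other (c := 1)) // h1.
split=> v /h/andP[v1 v0]; first by rewrite (degree_off_other (i := x1)) ?x1E.
by rewrite (degree_off_other (i := x0)).
Qed.

Variables a0 a1 : nat.
Hypotheses (a1_gt0 : (0 < a1)%N) (a1_le : (a1 <= a0)%N).

(** Layer d has degree (a1 - d) + (a0 - d) + d with truncated differences, that is
    a0 if a1 <= d and a0 + a1 - d otherwise. *)
Definition fat_betti (q : nat) (e : int) : nat :=
  (power_betti (n - 1) a0 q e + \sum_(0 <= d < a0)
    (e == (q + maxn a0 (a0 + a1 - d))%:Z) * ('C(d + n - 2, d) * 'C(n - 1, q)))%N.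

(** This is the tower of the chain g d = x_0^(a1 - d) x_1^(a0 - d) over the power
    a0 of the ideal of the remaining variables; g is trivial from d = a0 >= a1 on. *)
Lemma has_betti_two_fat_points :
  has_betti (two_fat_points k n a0 a1) (quotient_betti fat_betti).
Proof.
have a0_gt0 : (0 < a0)%N by apply: leq_trans a1_le.
pose Y := other_vars; pose g d := (U_(x0) *+ (a1 - d) + U_(x1) *+ (a0 - d))%MM.
have gE d i : g d i = ((x0 == i) * (a1 - d) + (x1 == i) * (a0 - d))%N.
  by rewrite mnmDE !mulmnE !mnm1E.
have gdeg d : mdeg (g d) = ((a1 - d) + (a0 - d))%N.
  by rewrite mdegD !mdegMn !mdeg1 !mul1n.
have gY d i : i \in Y -> g d i = 0%N.
  rewrite mem_other_vars gE -!val_eqE /= -/x1 x1E => i1.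
  by rewrite (ltn_eqF i1) (ltn_eqF (ltnW i1)).
have g_anti d : (g d.+1 <= g d)%MM.
  by apply/mnm_lepP=> i; rewrite !gE leq_add // leq_mul2l leq_sub2l ?orbT.
have g_strict d : (d < a0)%N -> (mdeg (g d.+1) < mdeg (g d))%N.
  by rewrite !gdeg; lia.
have base : has_betti (@monomial_ideal k n.+1 (tower Y g a0))
    (quotient_betti (power_betti (size Y) a0)).
  apply: has_betti_ext (has_betti_power k other_vars_uniq a0_gt0) => // p.
  apply: mono_ext => v.
  rewrite /tower; case: leqP => //= av; apply/esym/mnm_lepP=> i; rewrite gE.
  by rewrite (eqP av) (eqP (leq_trans a1_le av)) !muln0.
have degc q e : power_betti (size Y) a0 q e != 0%N ->
    e <= (q + (mdeg (g a0) + a0))%:Z.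
  by rewrite muln_eq0 negb_or eqb0 negbK => /andP[/eqP-> _]; rewrite gdeg; lia.
have := has_betti_tower other_vars_uniq gY g_anti g_strict a0_gt0 (leqnn a0) degc base.
rewrite subnn; apply: has_betti_ext => [p|[|q] e] //=.
  rewrite two_fat_pointsP; apply: mono_ext => v; rewrite /tower /=.
  apply/mnm_lepP/andP=> [le|[le1 le0] i].
    have := le x1; have := le x0; rewrite !gE !eqxx -!val_eqE /= x1E.
    by rewrite mul0n !mul1n; lia.
  rewrite gE; case: (x0 =P i) => [<-|_]; last case: (x1 =P i) => [<-|//].
    by rewrite -!val_eqE /= x1E /= mul0n addn0 mul1n leq_subLR addnC.
  by rewrite mul1n leq_subLR addnC.
rewrite /fat_betti size_other_vars; congr (_ + _)%N.
apply: eq_big_nat => d /andP[_ da]; rewrite /layer_betti gdeg size_other_vars.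
have -> : (a1 - d + (a0 - d) + d = maxn a0 (a0 + a1 - d))%N by lia.
by have -> : (d + (n - 1) - 1 = d + n - 2)%N by lia.
Qed.

Lemma two_fat_points_graded_ideal : graded_ideal (two_fat_points k n a0 a1).
Proof.
have up : up_closed (fun v => (a0 <= v x1 + degree_in other_vars v)
    && (a1 <= v x0 + degree_in other_vars v))%N.
  by move=> u v; rewrite degree_inD !mnmDE; lia.
have gI := mono_graded_ideal k up.
split=> [p q|c p|d p]; rewrite !two_fat_pointsP.
- exact: gidealD.
- exact: gidealM.
exact: gideal_hcomp.
Qed.

End PointPowers.

(** * The graded Betti numbers *)

Section FatBettiValues.
Variables n a0 a1 : nat.
Hypotheses (n_ge2 : (2 <= n)%N) (a1_gt0 : (0 < a1)%N) (a1_le : (a1 <= a0)%N).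

(** The layers d >= a1 are those generated in degree a0; the index i is a0 - d. *)
Lemma fat_betti_linear q : fat_betti n a0 a1 q (q + a0)%:Z =
  ('C(a0 + n - 2, a0 + q) * 'C(a0 + q - 1, q)
   + \sum_(1 <= i < (a0 - a1).+1) 'C(a0 - i + n - 2, a0 - i) * 'C(n - 1, q))%N.
Proof.
rewrite /fat_betti /power_betti eqxx mul1n.
have -> : (a0 + (n - 1) - 1 = a0 + n - 2)%N by lia.
congr (_ + _)%N; rewrite (big_cat_nat (n := a1)) //= big1_seq ?add0n; last first.
  move=> d; rewrite mem_index_iota => /andP[_ da1].
  by rewrite (_ : (_ == _) = false) //; apply/eqP; lia.
rewrite -[in LHS](add0n a1) big_addn [in RHS]big_add1 /= [in RHS]big_nat_rev /=.
apply: eq_big_nat => d /andP[_ da]; rewrite add0n.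
have -> : (a0 - (a0 - a1 - d.+1).+1 = d + a1)%N by lia.
rewrite (_ : (_ == _) = true) ?mul1n //; apply/eqP; lia.
Qed.

(** Only the layer d = a1 - i - 1 has generators of degree a0 + i + 1. *)
Lemma fat_betti_nonlinear q i : (i < a1)%N ->
  fat_betti n a0 a1 q (q.+1 + a0 + i)%:Z =
  ('C(a1 - i + n - 3, a1 - i - 1) * 'C(n - 1, q))%N.
Proof.
move=> ia1; rewrite /fat_betti /power_betti (_ : (_ == _) = false) ?mul0n ?add0n.
  rewrite (bigD1_seq (a1 - i - 1)%N) ?iota_uniq //=; last first.
    by rewrite mem_index_iota; lia.
  rewrite big1_seq ?addn0 => [|d /andP[di]]; last first.
    rewrite mem_index_iota => /andP[_ da0].
    by rewrite (_ : (_ == _) = false) //; apply/eqP; lia.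
  rewrite (_ : (_ == _) = true) ?mul1n; last by apply/eqP; lia.
  by have -> : (a1 - i - 1 + n - 2 = a1 - i + n - 3)%N by lia.
by apply/eqP; lia.
Qed.

Lemma fat_betti_eq0 q e : e != (q + a0)%:Z ->
  (forall i, (i < a1)%N -> e != (q.+1 + a0 + i)%:Z) -> fat_betti n a0 a1 q e = 0%N.
Proof.
move=> /negbTE e0 ei; rewrite /fat_betti /power_betti e0 mul0n add0n.
rewrite big1_seq // => d /andP[_]; rewrite mem_index_iota => /andP[_ da0].
case: (leqP a1 d) => da1.
  have -> : maxn a0 (a0 + a1 - d) = a0 by lia.
  by rewrite e0.
have -> : (q + maxn a0 (a0 + a1 - d) = q.+1 + a0 + (a1 - d - 1))%N by lia.
by rewrite (negbTE (ei _ _)) //; lia.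
Qed.

End FatBettiValues.

Theorem theorem2p7 (k : fieldType) (n a0 a1 : nat)
    (hn : (2 <= n)%N) (ha1 : (0 < a1)%N) (ha : (a1 <= a0)%N) :
  [/\ forall q : nat, (0 < q)%N ->
        graded_betti (two_fat_points k n a0 a1) q (Posz (q + a0 - 1)%N)
          ('C(a0 + n - 2, a0 + q - 1) * 'C(a0 + q - 2, q - 1)
           + \sum_(1 <= i < (a0 - a1).+1)
               'C(a0 - i + n - 2, a0 - i) * 'C(n - 1, q - 1))%N,
      forall q i : nat, (0 < q)%N -> (i < a1)%N ->
        graded_betti (two_fat_points k n a0 a1) q (Posz (q + a0 + i)%N)
          ('C(a1 - i + n - 3, a1 - i - 1) * 'C(n - 1, q - 1))%N,
      graded_betti (two_fat_points k n a0 a1) 0 (Posz 0) 1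
    & forall (q : nat) (j : int),
        ~ (q = 0%N /\ j = Posz 0) ->
        ~ ((0 < q)%N /\ j = Posz (q + a0 - 1)%N) ->
        ~ ((0 < q)%N /\ exists2 i : nat, (i < a1)%N & j = Posz (q + a0 + i)%N) ->
        graded_betti (two_fat_points k n a0 a1) q j 0].
Proof.
have key q j b : quotient_betti (fat_betti n a0 a1) q j = b ->
    graded_betti (two_fat_points k n a0 a1) q j b.
  move=> <-; apply: graded_betti_has; last exact: has_betti_two_fat_points.
  exact: two_fat_points_graded_ideal.
split=> [[//|q] _|[//|q] i _ ia1||[|q] j j0 j1 j2]; apply: key => //=.
- have -> : (q.+1 + a0 - 1 = q + a0)%N by lia.
  rewrite fat_betti_linear //; have -> : (a0 + q.+1 - 1 = a0 + q)%N by lia.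
  have -> : (a0 + q.+1 - 2 = a0 + q - 1)%N by lia.
  by have -> : (q.+1 - 1 = q)%N by lia.
- by rewrite fat_betti_nonlinear //; have -> : (q.+1 - 1 = q)%N by lia.
- by case: (j =P 0) j0 => // -> [].
apply: fat_betti_eq0 => // [|i ia1]; apply/eqP => jE.
  by apply: j1; split=> //; rewrite jE; congr Posz; lia.
by apply: j2; split=> //; exists i.
Qed.
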